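(* Let $\ell\ge 1$ and $n\ge 2\ell+1$ be integers with $(n,\ell)\ne(5,2)$. Then the family of $n$-vertex trees is $\ell$-recognizable; that is, if $T$ is an $n$-vertex tree and $G$ is an $n$-vertex graph having the same $(n-\ell)$-deck as $T$, then $G$ is a tree.
   Context: All graphs are finite and simple. The $(n-\ell)$-deck of an $n$-vertex graph is the multiset (of isomorphism classes) of its induced subgraphs with $n-\ell$ vertices. A family of $n$-vertex graphs is $\ell$-recognizable if every $n$-vertex graph having the same $(n-\ell)$-deck as a graph in the family is also in the family. *)

(* Defs.v *)
From HB Require Import structures.
From mathcomp Require Import all_boot.

Set Implicit Arguments.
Unset Strict Implicit.
Unset Printing Implicit Defensive.

Record sgraph := SGraph {
  vertex :> finType;
  adj : rel vertex;
  adj_sym : symmetric adj;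
  adj_irrefl : irreflexive adj }.

Section Induced.
Variables (G : sgraph) (S : {set G}).

Definition induced_adj : rel {x : G | x \in S} :=
  [rel x y | adj (val x) (val y)].

Lemma induced_adj_sym : symmetric induced_adj.
Proof. by move=> x y; apply: adj_sym. Qed.

Lemma induced_adj_irrefl : irreflexive induced_adj.
Proof. by move=> x; apply: adj_irrefl. Qed.

Definition induced : sgraph := SGraph induced_adj_sym induced_adj_irrefl.

End Induced.

(* Boolean, so that the subsets inducing a given graph can be counted;
   [isoP] gives the propositional form. *)
Definition iso (G H : sgraph) : bool :=
  [exists f : {ffun G -> H}, exists g : {ffun H -> G},
    [&& [forall x, g (f x) == x], [forall y, f (g y) == y] &
        [forall x, forall y, adj (f x) (f y) == adj x y]]].

Lemma isoP (G H : sgraph) :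
  reflect (exists2 f : G -> H, bijective f &
             forall x y, adj (f x) (f y) = adj x y)
          (iso G H).
Proof.
apply: (iffP existsP) => [[f /existsP[g /and3P[/forallP fK /forallP gK /forallP fE]]]|].
  exists f; first by exists g => x; apply/eqP.
  by move=> x y; apply/eqP/(forallP (fE x)).
case=> f [g fK gK] fE; exists (finfun f); apply/existsP; exists (finfun g).
apply/and3P; split; apply/forallP => x; rewrite ?ffunE ?fK ?gK //.
by apply/forallP => y; rewrite !ffunE fE.
Qed.

(* The k-deck as a multiset of isomorphism classes, given by its multiplicity
   function: the class of H occurs [deck k G H] times. *)
Definition deck (k : nat) (G H : sgraph) : nat :=
  #|[set S : {set G} | (#|S| == k) && iso (induced S) H]|.

Definition same_deck (k : nat) (G1 G2 : sgraph) : Prop :=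
  forall H : sgraph, deck k G1 H = deck k G2 H.

Definition connected (G : sgraph) : Prop :=
  0 < #|G| /\ forall x y : G, connect (@adj G) x y.

(* [ucycle] also holds of the empty sequence and of [:: x; y] for an edge xy,
   so a graph cycle is a [ucycle] of size at least 3. *)
Definition acyclic (G : sgraph) : Prop :=
  forall c : seq G, 2 < size c -> ~ ucycle (@adj G) c.

Definition is_tree (G : sgraph) : Prop := connected G /\ acyclic G.

(* The family consists of the n-vertex graphs satisfying F. *)
Definition recognizable (n l : nat) (F : sgraph -> Prop) : Prop :=
  forall T G : sgraph, #|T| = n -> #|G| = n ->
    F T -> same_deck (n - l) G T -> F G.

(* Main.v *)
(* Let [k = n - l], so that [n < 2k], and suppose that [G] has the [k]-deck of a
   tree [T] but is not a tree. Both graphs have the same numbers of labelled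
   induced subgraphs on at most [k] vertices. Hence [G] has [n - 1] edges and no
   cycle of length at most [k], so it has a shortest cycle [C] with more than [k]
   vertices and a component [Z] that misses [C].

   Consider balls around vertices (radius [r], diameter [2r]) and around edges
   (radius [r], diameter [2r + 1]). If in [G] and [T] no ball of diameter [d] has
   more than [k] vertices, then, by downward induction on the size, [G] and [T]
   have the same rooted balls of diameter [d]; call such a [d] visible. In [T] a
   visible ball always has vertices at distance exactly [r] from its root, so
   this holds in [G] too, and forces [Z] to have at least [d] vertices.

   Let [d] be least such that some ball of diameter [d] has at least [k] vertices.
   As [d - 1] is visible, [|Z| >= d - 1]. There are then too few vertices off [C]
   for a short detour between two vertices of [C], so a ball of diameter [d] meets
   [C] in at most [d + 1] vertices and has at most [k] vertices. If [d] were
   visible, then [|Z| >= d], and the balls of diameter [d] in [G] would have fewer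
   than [k] vertices. So [T] has a ball [B] of diameter [d] with more than [k]
   vertices.

   If [d = 2r + 1], count the vertices with two branches of depth [r]: going down
   [r] steps from such a vertex leaves [B], so [T] has at most [2 + n - |B| <= k] of
   them, while all vertices of [C] are of this kind. If [d = 2r], counting the
   edges with depth [r - 1] on both sides in the same way shows that the centre of
   [B] has three branches of depth [r]. Leaving out one of their tips, we find in
   [T] three star-shaped sets of [k] vertices whose centre has three branches of
   depth [max (r - 1) 1]; the case [(n, l) = (5, 2)] is the one where there is no
   room for the third branch. In [G] such a set is a ball, its centre is on [C]
   and has a branch off [C] that every other such ball contains, so the centres
   are pairwise adjacent and there are at most two of them. *)
Require Import Defs.
From mathcomp Require Import all_boot zify.

Set Implicit Arguments.
Unset Strict Implicit.
Unset Printing Implicit Defensive.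

(** * Paths and distances *)

Lemma path_adj_rev (G : sgraph) (x : G) p :
  path (@adj G) (last x p) (rev (belast x p)) = path (@adj G) x p.
Proof. by rewrite rev_path; apply: eq_path => a b; rewrite adj_sym. Qed.

Lemma path_rcons_rev (G : sgraph) (x y : G) p :
  path (@adj G) y (rcons (rev p) x) = path (@adj G) x (rcons p y).
Proof.
by rewrite -[RHS]path_adj_rev last_rcons belast_rcons rev_cons.
Qed.

(* At the first common vertex after the point where they split, the two paths
   close up to a cycle. *)
Lemma two_paths_cycle (G : sgraph) (a : G) p q :
  path (@adj G) a p -> path (@adj G) a q -> uniq (a :: p) -> uniq (a :: q) ->
  last a p = last a q -> p <> q ->
  exists c : seq G, [/\ ucycle (@adj G) c, 2 < size c & size c <= size p + size q].
Proof.
elim: p a q => [|x p IHp] a q.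
  case: q => [|y q] //= _ _ _ /andP[aNq _] def_a _.
  by rewrite def_a mem_last in aNq.
case: q => [|y q].
  move=> _ _ /= /andP[aNp _] _ def_a _.
  by rewrite -{1}def_a mem_last in aNp.
have [<-|neq_xy] := eqVneq x y.
  move=> /= /andP[axp pp] /andP[_ pq] /andP[_ up] /andP[_ uq] eql neq.
  have [|c [cc c2 cs]] := IHp x q pp pq up uq eql; first by move=> e; rewrite e in neq.
  by exists c; split=> //; lia.
move=> pp pq up uq eql _.
have has_p: has (mem (y :: q)) (x :: p).
  apply/hasP; exists (last a (x :: p)); first by rewrite /= mem_last.
  by rewrite eql /= mem_last.
have [n hn] : exists n, n = find (mem (y :: q)) (x :: p) by exists (find (mem (y :: q)) (x :: p)).
move: has_p; rewrite has_find -hn => ltn.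
set w := nth a (x :: p) n.
have wq : w \in y :: q.
  by rewrite /w hn; apply: (@nth_find _ a (mem (y :: q))); rewrite has_find -hn.
have p1N z : z \in take n (x :: p) -> z \notin y :: q.
  move=> /(nthP a)[i]; rewrite size_take_min leq_min => /andP[lt_in _] <-.
  rewrite nth_take // ; apply/negP => zq.
  by have := @before_find _ a (mem (y :: q)) (x :: p) i; rewrite -hn => /(_ lt_in); rewrite /= zq.
have def_p : x :: p = rcons (take n (x :: p)) w ++ drop n.+1 (x :: p).
  by rewrite -take_nth // cat_take_drop.
have [m hm] : exists m, m = index w (y :: q) by exists (index w (y :: q)).
have ltm : m < size (y :: q) by rewrite hm index_mem.
have def_q : y :: q = rcons (take m (y :: q)) w ++ drop m.+1 (y :: q).
  have nm : nth a (y :: q) m = w by rewrite hm nth_index.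
  by rewrite -nm -take_nth // cat_take_drop.
set p1 := take n _ in def_p p1N; set q1 := take m _ in def_q.
have sp1 : size p1 = n by rewrite /p1 size_takel // ltnW.
have sq1 : size q1 = m by rewrite /q1 size_takel // ltnW.
(* The cycle runs along [p1] to the meeting vertex [w] and back along [q1]. It has [n + m + 2]
   vertices, more than 2 because [n = m = 0] would give [x = w = y]. *)
exists (a :: rcons p1 w ++ rev q1); split; last 2 first.
- rewrite /= size_cat size_rcons size_rev sp1 sq1.
  have: (n, m) != (0, 0).
    apply/eqP => -[n0 m0]; move: def_p def_q; rewrite /p1 /q1 n0 m0 !take0 /= => -[exw _] -[eyw _].
    by rewrite exw eyw eqxx in neq_xy.
  rewrite xpair_eqE; lia.
- by rewrite /= size_cat size_rcons size_rev sp1 sq1; move: ltn ltm => /=; lia.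
rewrite /ucycle /= rcons_cat cat_path last_rcons.
rewrite def_p cat_path in pp; rewrite def_q cat_path in pq.
case/andP: pp => pp _; case/andP: pq => pq _.
rewrite pp path_rcons_rev pq /=.
move: up uq; rewrite def_p def_q /=.
rewrite !mem_cat !cat_uniq !rcons_uniq !mem_rcons !inE !negb_or mem_rev rev_uniq.
case/andP=> /andP[/andP[aNw aNp1] _] /and3P[/andP[wNp1 up1] _ _].
case/andP=> /andP[/andP[_ aNq1] _] /and3P[/andP[wNq1 uq1] _ _].
rewrite aNw aNp1 aNq1 wNp1 up1 uq1 /= andbT.
apply/hasPn => z; rewrite mem_rev => zq1. rewrite mem_rcons inE.
rewrite negb_or; apply/andP; split; first by apply: contraNneq wNq1 => <-.
apply: contraL zq1 => /p1N; rewrite def_q mem_cat mem_rcons inE !negb_or.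
by case/andP=> /andP[].
Qed.

(** The start [x] need not lie in [D], only the later vertices of the walk. With [D = setT] this is
    distance at most [r], and it is simply false between different components. *)
Fixpoint within (G : sgraph) (D : {set G}) (r : nat) (x z : G) : bool :=
  if r is r'.+1 then
    (x == z) || [exists y, [&& y \in D, adj x y & within D r' y z]]
  else x == z.

Lemma withinP (G : sgraph) (D : {set G}) r x z :
  reflect (exists p, [/\ path (@adj G) x p, last x p = z, size p <= r &
                         {subset p <= D}])
          (within D r x z).
Proof.
elim: r x => [|r IHr] x /=.
  apply: (iffP eqP) => [->|[[|y p] []//]]; by exists [::].
apply: (iffP idP) => [/orP[/eqP->|/existsP[y /and3P[yD axy /IHr[p [pp lp sp Dp]]]]]|].
- by exists [::].
- exists (y :: p); split=> //=; first by rewrite axy.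
  by move=> w; rewrite inE => /predU1P[->|/Dp].
case=> [[|y p]] [/=]; first by move=> _ -> _ _; rewrite eqxx.
case/andP=> axy pp lp sp Dp; apply/orP; right; apply/existsP; exists y.
rewrite axy Dp ?mem_head //=; apply/IHr; exists p; split=> // w wp.
by apply: Dp; rewrite inE wp orbT.
Qed.

Lemma within0 (G : sgraph) (D : {set G}) r x : within D r x x.
Proof. by case: r => [|r] /=; rewrite eqxx. Qed.

Lemma within_mono (G : sgraph) (D E : {set G}) r s x z :
  D \subset E -> r <= s -> within D r x z -> within E s x z.
Proof.
move=> /subsetP DE le_rs /withinP[p [pp lp sp Dp]]; apply/withinP; exists p.
by split=> // [|w /Dp/DE//]; apply: leq_trans le_rs.
Qed.

Lemma within_leq (G : sgraph) (D : {set G}) r s x z :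
  r <= s -> within D r x z -> within D s x z.
Proof. by move=> le_rs; apply: within_mono le_rs. Qed.

Lemma within_setT (G : sgraph) (D : {set G}) r x z :
  within D r x z -> within setT r x z.
Proof. exact: within_mono (subsetT D) (leqnn r). Qed.

Lemma within_trans (G : sgraph) (D : {set G}) r s x y z :
  within D r x y -> within D s y z -> within D (r + s) x z.
Proof.
move=> /withinP[p [pp lp sp Dp]] /withinP[q [pq lq sq Dq]]; apply/withinP.
exists (p ++ q); rewrite cat_path pp lp pq last_cat lp lq size_cat leq_add //.
by split=> // w; rewrite mem_cat => /orP[/Dp|/Dq].
Qed.

Lemma within_path (G : sgraph) (x : G) p :
  path (@adj G) x p -> within setT (size p) x (last x p).
Proof. by move=> pp; apply/withinP; exists p; split=> // w _; rewrite inE. Qed.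

Lemma within_adj (G : sgraph) (D : {set G}) x y :
  y \in D -> adj x y -> within D 1 x y.
Proof.
move=> yD axy; apply/withinP; exists [:: y]; rewrite /= axy; split=> // w.
by rewrite inE => /eqP->.
Qed.

Lemma within_cons (G : sgraph) (D : {set G}) r x y z :
  y \in D -> adj x y -> within D r y z -> within D r.+1 x z.
Proof. by move=> yD axy; apply: within_trans (within_adj yD axy). Qed.

Lemma within_sym (G : sgraph) r (x z : G) :
  within setT r x z = within setT r z x.
Proof.
suff sym a b : within setT r a b -> within [set: G] r b a by apply/idP/idP; apply: sym.
case/withinP=> p [pp <- sp _]; apply/withinP; exists (rev (belast a p)).
rewrite path_adj_rev size_rev size_belast; split=> // [|w _]; last by rewrite inE.
by case: p {pp sp} => //= c p; rewrite rev_cons last_rcons.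
Qed.

Lemma within_uniq (G : sgraph) (D : {set G}) r x z :
  within D r x z ->
  exists p, [/\ path (@adj G) x p, last x p = z, size p <= r,
                {subset p <= D} & uniq (x :: p)].
Proof.
case/withinP=> p [pp <- sp Dp]; have [q pq uq sub_qp] := shortenP pp.
exists q; split=> //; last by move=> w /sub_qp/Dp.
by apply: leq_trans sp; apply: uniq_leq_size => //; case/andP: uq.
Qed.

(** If [x] lay on the path, the rest of the path from [x] on would lead to [z] in at most [t]
    steps. *)
Lemma notin_short_path (G : sgraph) (t : nat) (x y z : G) p :
  path (@adj G) y p -> last y p = z -> size p <= t -> ~~ within setT t x z ->
  x \notin y :: p.
Proof.
move=> pp lp sp; apply: contra => xp.
case/splitPl: p / xp pp lp sp => p1 p2 lp1.
rewrite cat_path last_cat size_cat lp1 => /andP[_ pp2] lp2 sp.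
apply/withinP; exists p2; split=> // [|w _]; last by rewrite inE.
by apply: leq_trans sp; apply: leq_addl.
Qed.

Lemma connect_within (G : sgraph) (x z : G) :
  connect (@adj G) x z -> within setT #|G| x z.
Proof.
case/connectP=> p pp ->; have [q pq uq _] := shortenP pp.
apply: within_leq (within_path pq); rewrite ltnW //.
by rewrite -/(size (x :: q)) -(card_uniqP uq) max_card.
Qed.

Lemma within_connect (G : sgraph) (D : {set G}) r (x z : G) :
  within D r x z -> connect (@adj G) x z.
Proof. by case/withinP=> p [pp <- _ _]; apply/connectP; exists p. Qed.

(** Between different components the search fails and returns [#|G|.+1], so comparisons with
    [within] assume [connect]. *)
Definition dist (G : sgraph) (x z : G) : nat :=
  find (fun r => within setT r x z) (iota 0 #|G|.+1).

Lemma leq_dist (G : sgraph) r (x z : G) :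
  connect (@adj G) x z -> (dist x z <= r) = within setT r x z.
Proof.
move=> cxz; have w_n := connect_within cxz.
have has_w : has (fun r => within setT r x z) (iota 0 #|G|.+1).
  by apply/hasP; exists #|G|; rewrite ?mem_iota /=.
apply/idP/idP => [le_r|w_r].
  apply: within_leq le_r _; have := nth_find 0 has_w.
  by rewrite nth_iota // -[X in _ < X](size_iota 0) -has_find.
rewrite leqNgt; apply/negP => lt_r.
have lt_n : dist x z < #|G|.+1 by rewrite -[X in _ < X](size_iota 0) -has_find.
have := before_find 0 lt_r; rewrite nth_iota ?add0n ?w_r //.
exact: ltn_trans lt_r lt_n.
Qed.

Lemma dist_sym (G : sgraph) (x z : G) : dist x z = dist z x.
Proof. by apply: eq_find => r; rewrite within_sym. Qed.

Lemma connect_adj_sym (G : sgraph) : connect_sym (@adj G).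
Proof. exact: sym_connect_sym (@adj_sym G). Qed.

Lemma dist_refl (G : sgraph) (x : G) : dist x x = 0.
Proof. by apply/eqP; rewrite -leqn0 leq_dist ?within0. Qed.

Lemma dist_triangle (G : sgraph) (x y z : G) :
  connect (@adj G) x y -> connect (@adj G) y z ->
  dist x z <= dist x y + dist y z.
Proof.
move=> cxy cyz; rewrite leq_dist ?(connect_trans cxy) //.
by apply: (@within_trans _ _ _ _ x y z); rewrite -leq_dist.
Qed.

Lemma dist_adj (G : sgraph) (x y z : G) :
  adj x y -> connect (@adj G) y z -> dist x z <= (dist y z).+1.
Proof.
move=> axy cyz; rewrite leq_dist ?(connect_trans (connect1 axy)) //.
by apply: within_cons (in_setT y) axy _; rewrite -leq_dist.
Qed.

(* For [D = setT]: some shortest path of length [t + 1] from [x] starts with the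
   edge [xy]. Testing [within] is enough, as the distances of [x] and [y] to [z]
   differ by at most one. *)
Definition arc_to (G : sgraph) (D : {set G}) (t : nat) (x y : G) : bool :=
  adj x y && [exists z in D, within D t y z && ~~ within D t x z].

Lemma acyclic_unique_path (G : sgraph) (a : G) p q :
  acyclic G -> path (@adj G) a p -> path (@adj G) a q ->
  uniq (a :: p) -> uniq (a :: q) -> last a p = last a q -> p = q.
Proof.
move=> acG pp pq up uq eql; apply/eqP/negPn/negP => /eqP neq.
have [c [cc c2 _]] := two_paths_cycle pp pq up uq eql neq.
exact: acG cc.
Qed.

(** Neither short path passes through [x], so prefixing [x] gives two simple paths from [x] to [z].
    In a forest they coincide, and so do their first steps. *)
Lemma closer_unique (G : sgraph) t (x y y' z : G) :
  acyclic G -> adj x y -> adj x y' ->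
  within setT t y z -> within setT t y' z -> ~~ within setT t x z -> y = y'.
Proof.
move=> acG axy axy' /within_uniq[p [pp lp sp _ up]].
move=> /within_uniq[q [pq lq sq _ uq]] xz.
have xp := notin_short_path pp lp sp xz; have xq := notin_short_path pq lq sq xz.
suff: y :: p = y' :: q by case.
by apply: (@acyclic_unique_path G x) => //=; rewrite ?axy ?axy' ?xp ?xq ?lp ?lq.
Qed.

(** A shortest path from [y], prefixed by [x], is simple and one edge longer than the common
    distance. By uniqueness it would be the shortest path from [x]. *)
Lemma dist_adj_neq (G : sgraph) (x y z : G) :
  acyclic G -> adj x y -> connect (@adj G) x z -> dist x z <> dist y z.
Proof.
move=> acG axy cxz eqd.
have cyz : connect (@adj G) y z.
  by apply: connect_trans cxz; apply: connect1; rewrite adj_sym.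
have [t lt_t] : exists t, t = dist x z by exists (dist x z).
have [q [pq lq sq _ uq]] : exists q, [/\ path (@adj G) y q, last y q = z,
    size q <= t, {subset q <= [set: G]} & uniq (y :: q)].
  by apply: within_uniq; rewrite -leq_dist // lt_t eqd.
have [p [pp lp sp _ up]] : exists p, [/\ path (@adj G) x p, last x p = z,
    size p <= t, {subset p <= [set: G]} & uniq (x :: p)].
  by apply: within_uniq; rewrite -leq_dist // lt_t.
have xNy : x != y by apply: contraTneq axy => ->; rewrite adj_irrefl.
have size_q : size q = t.
  apply/eqP; rewrite eqn_leq sq lt_t eqd leq_dist //.
  by rewrite -lq within_path.
have xq : x \notin y :: q.
  case: q pq lq sq uq size_q => [|w q] pq lq sq uq size_q; first by rewrite inE.
  rewrite inE negb_or xNy /=; apply/negP=> xq.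
  move: pq lq => /= /andP[_ pq] lq; have := notin_short_path pq lq (leqnn _).
  move=> /(_ x); rewrite xq -leq_dist // -lt_t -size_q /= ltnn => /(_ isT) //.
have : p = y :: q.
  by apply: (@acyclic_unique_path G x) => //=; rewrite ?axy ?xq ?lp ?lq.
by move=> def_p; move: sp; rewrite def_p /= size_q ltnn.
Qed.

Lemma dist_adj_cases (G : sgraph) (x y z : G) :
  acyclic G -> adj x y -> connect (@adj G) x z ->
  dist x z = (dist y z).+1 \/ dist y z = (dist x z).+1.
Proof.
move=> acG axy cxz.
have ayx : adj y x by rewrite adj_sym.
have := dist_adj_neq acG axy cxz; have := dist_adj ayx cxz.
have := dist_adj axy (connect_trans (connect1 ayx) cxz); lia.
Qed.

(** * Labelled patterns and the deck *)

(** The adjacency matrix of the labelled induced subgraph on [s]. Counting labelled copies avoids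
    counting automorphisms. *)
Definition pattern (G : sgraph) (s : seq G) : seq (seq bool) :=
  [seq [seq adj x y | y <- s] | x <- s].

Lemma size_pattern (G H : sgraph) (s : seq G) (t : seq H) :
  pattern s = pattern t -> size s = size t.
Proof. by move=> /(congr1 size); rewrite !size_map. Qed.

Lemma pattern_nth (G H : sgraph) (x0 : G) (y0 : H) (s : seq G) (t : seq H) i j :
  pattern s = pattern t -> i < size s -> j < size s ->
  adj (nth x0 s i) (nth x0 s j) = adj (nth y0 t i) (nth y0 t j).
Proof.
move=> eqp lti ltj; have eqs := size_pattern eqp.
have := congr1 (fun A => nth false (nth [::] A i) j) eqp.
by rewrite /= (nth_map x0) // (nth_map x0) // (nth_map y0) -?eqs // (nth_map y0) -?eqs.
Qed.

Lemma pattern_take (G H : sgraph) (s : seq G) (t : seq H) i :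
  pattern s = pattern t -> pattern (take i s) = pattern (take i t).
Proof.
have take_pat (K : sgraph) (u : seq K) :
    pattern (take i u) = [seq take i r | r <- take i (pattern u)].
  by rewrite -map_take -map_comp; apply: eq_map => x /=; rewrite map_take.
by rewrite !take_pat => ->.
Qed.

Lemma pattern_map (G H : sgraph) (f : G -> H) (s : seq G) :
  (forall x y, adj (f x) (f y) = adj x y) -> pattern (map f s) = pattern s.
Proof.
by move=> fE; rewrite /pattern -map_comp; apply: eq_map => x /=;
   rewrite -map_comp; apply: eq_map => y /=.
Qed.

(** Both counts are split by the value of [f] and [h]. On the fibres of one value [P] and [Q] are
    constant and equal, so these fibres count fully on both sides or not at all. *)
Lemma card_fibers (I J : finType) (E : eqType) (f : I -> E) (h : J -> E)
    (X P : pred I) (Y Q : pred J) :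
  (forall e, #|[set x | X x && (f x == e)]| = #|[set y | Y y && (h y == e)]|) ->
  (forall x y, X x -> Y y -> f x = h y -> P x = Q y) ->
  #|[set x | X x && P x]| = #|[set y | Y y && Q y]|.
Proof.
move=> eqXY eqPQ.
(* [E] may be infinite, so the sums run over the values that occur. *)
pose L := undup ([seq f x | x <- enum I] ++ [seq h y | y <- enum J]).
have split_sum (K : finType) (g : K -> E) (Z : pred K) :
    {subset [seq g x | x <- enum K] <= L} ->
    #|[set x | Z x]| = \sum_(e <- L) #|[set x | Z x && (g x == e)]|.
  move=> subL; rewrite -sum1_card (eq_bigl Z); last by move=> x; rewrite inE.
  transitivity (\sum_(x | Z x) \sum_(e <- L | g x == e) 1).
    apply: eq_bigr => x _; rewrite sum1_count.
    rewrite (@eq_count _ _ (pred1 (g x))); last by move=> e; rewrite /= eq_sym.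
    by rewrite count_uniq_mem ?undup_uniq // subL // map_f // mem_enum.
  rewrite (exchange_big_dep xpredT) //=; apply: eq_bigr => e _.
  by rewrite -sum1_card; apply: eq_bigl => x; rewrite inE.
rewrite (@split_sum _ f) ?(@split_sum _ h); first last.
- by move=> e he; rewrite mem_undup mem_cat he.
- by move=> e he; rewrite mem_undup mem_cat he orbT.
apply: eq_bigr => e _.
case: (set_0Vmem [set x | X x && (f x == e)]) => [X0|[x0 /[!inE]/andP[Xx0 fx0]]].
  have Y0 : [set y | Y y && (h y == e)] = set0.
    by apply/eqP; rewrite -cards_eq0 -eqXY X0 cards0.
  have -> : [set x | X x && P x && (f x == e)] = set0.
    apply/setP => x; move/setP: X0 => /(_ x); rewrite !inE.
    by case: (X x) (f x == e) => [] [] // _; rewrite andbF.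
  have -> : [set y | Y y && Q y && (h y == e)] = set0.
    apply/setP => y; move/setP: Y0 => /(_ y); rewrite !inE.
    by case: (Y y) (h y == e) => [] [] // _; rewrite andbF.
  by rewrite !cards0.
have /card_gt0P[y0 /[!inE]/andP[Yy0 hy0]] : 0 < #|[set y | Y y && (h y == e)]|.
  by rewrite -eqXY; apply/card_gt0P; exists x0; rewrite inE Xx0.
have PE : [set x | X x && P x && (f x == e)] = [set x | Q y0 && (X x && (f x == e))].
  apply/setP => x; rewrite !inE; case Xx: (X x) => /=; last by rewrite andbF.
  have [fx|] := eqVneq (f x) e; rewrite ?andbF // !andbT.
  by apply: eqPQ; rewrite // fx (eqP hy0).
have QE : [set y | Y y && Q y && (h y == e)] = [set y | Q y0 && (Y y && (h y == e))].
  apply/setP => y; rewrite !inE; case Yy: (Y y) => /=; last by rewrite andbF.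
  have [hy|] := eqVneq (h y) e; rewrite ?andbF // !andbT.
  transitivity (P x0); [symmetry|]; apply: eqPQ => //; rewrite (eqP fx0) //.
  by rewrite (eqP hy0).
rewrite PE QE; case: (Q y0); first exact: eqXY.
by rewrite !eq_card0 // => z; rewrite !inE.
Qed.

Lemma map_preimage (S : Type) (T : eqType) (f : S -> T) (s : seq T) :
  (forall x, x \in s -> exists y, f y = x) -> exists w, map f w = s.
Proof.
elim: s => [|x s IHs] fs; first by exists [::].
have [y <-] := fs x (mem_head _ _).
have [z zs|w <-] := IHs; first by apply: fs; rewrite inE zs orbT.
by exists (y :: w).
Qed.

Definition npat (G : sgraph) (k : nat) (A : seq (seq bool)) : nat :=
  #|[set t : k.-tuple G | uniq t && (pattern t == A)]|.

Lemma pattern_iso (G H : sgraph) (s : seq G) (u : seq H) :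
  uniq s -> uniq u -> pattern s = pattern u -> #|H| = size u ->
  iso (induced [set x in s]) H.
Proof.
move=> us uu eqp cardH; have eqs := size_pattern eqp.
have cardS : #|induced [set x in s]| = #|H|.
  by rewrite card_sig cardH -eqs -(card_uniqP us); apply: eq_card => x; rewrite !inE.
case: s => [|x0 s] in us eqp eqs cardS *.
  have noH : H -> False.
    by move=> y; have := fintype0 y; rewrite cardH -eqs => /(_ erefl).
  have noS : @induced G [set x in [::]] -> False by move=> x; have := valP x; rewrite inE.
  apply/isoP; exists (fun x => False_rect H (noS x)) => [|x]; last by case: (noS x).
  by exists (fun y => False_rect _ (noH y)) => z; [case: (noS z) | case: (noH z)].
case: u => [//|y0 u] in uu eqp eqs cardH *.
have ltx (x : induced [set x in x0 :: s]) : index (val x) (x0 :: s) < size (x0 :: s).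
  by rewrite index_mem; have := valP x; rewrite inE.
apply/isoP; exists (fun x => nth y0 (y0 :: u) (index (val x) (x0 :: s))).
  apply: inj_card_bij; last by rewrite cardS.
  move=> x y /eqP; rewrite nth_uniq -?eqs ?ltx // => /eqP eqi; apply: val_inj.
  by rewrite -(@nth_index _ x0 (val x) (x0 :: s)) ?eqi ?nth_index // -index_mem ltx.
move=> x y; rewrite -(pattern_nth x0 y0 eqp (ltx x) (ltx y)).
by rewrite !nth_index // -index_mem ltx.
Qed.

(** Labelled copies are grouped by their vertex set. A set inducing a copy of [H] carries as many
    enumerations with this pattern as [H] itself, transported by the isomorphism; any other set
    carries none. *)
Lemma npat_deck (G H : sgraph) k (u : k.-tuple H) :
  uniq u -> #|H| = k ->
  npat G k (pattern u) = deck k G H * npat H k (pattern u).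
Proof.
move=> uu cardH.
rewrite /npat -sum1_card (partition_big (fun t : k.-tuple G => [set x in t]) xpredT) //=.
rewrite /deck -sum_nat_const [RHS]big_mkcond /=; apply: eq_bigr => S _.
rewrite inE; case: ifP => [/andP[/eqP cardS /isoP[f [f' fK f'K] fE]]|/negP nS].
  pose g y := val (f' y).
  have g_inj : injective g by move=> y z /val_inj /(can_inj f'K).
  have gE x y : adj (g x) (g y) = adj x y by rewrite -[RHS](congr2 _ (f'K x) (f'K y)) fE.
  rewrite -(card_imset _ (_ : injective (map_tuple g))); last first.
    by move=> t1 t2 /(congr1 val) /= /(inj_map g_inj) /val_inj.
  rewrite -[RHS]sum1_card; apply: eq_bigl => t; rewrite inE.
  apply/andP/imsetP => [[/andP[ut pt] /eqP defS]|[w /[!inE]/andP[uw pw] ->]].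
    have [x xt|w def_t] := @map_preimage _ _ g t.
      have xS : x \in S by rewrite -defS inE.
      by exists (f (exist _ x xS)); rewrite /g fK.
    have sw : size w == k by rewrite -(size_map g) def_t size_tuple.
    exists (Tuple sw); last by apply: val_inj.
    by rewrite inE /= -(map_inj_uniq g_inj) -(pattern_map w gE) def_t ut.
  rewrite map_inj_uniq // uw /= (pattern_map _ gE) pw; split=> //.
  rewrite eqEcard cardS; apply/andP; split.
    by apply/subsetP => x; rewrite inE => /mapP[y _ ->]; apply: valP.
  by rewrite cardsE (card_uniqP _) ?map_inj_uniq //= size_map size_tuple.
apply/eqP; rewrite sum1_card; apply/negPn; rewrite -lt0n; apply/card_gt0P => -[t].
rewrite unfold_in => /andP[/[!inE]/andP[ut /eqP pt] /eqP defS]; apply: nS.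
rewrite -defS cardsE (card_uniqP ut) size_tuple eqxx.
by apply: pattern_iso ut uu pt _; rewrite size_tuple.
Qed.

(** A pattern that occurs in one of the graphs is the pattern of an enumeration of some [H] on [k]
    vertices, and [npat_deck] applies to both graphs with this [H]. *)
Lemma same_deck_npat (G T : sgraph) k :
  same_deck k G T -> forall A, npat G k A = npat T k A.
Proof.
have half (K : sgraph) A : same_deck k G T -> 0 < npat K k A -> npat G k A = npat T k A.
  move=> eq_deck /card_gt0P[t /[!inE]/andP[ut /eqP <-]].
  pose H := induced [set x in t].
  have [x xt|w def_t] := @map_preimage H _ val t.
    by have xS : x \in [set x in t]; [rewrite inE | exists (exist _ x xS)].
  have sw : size w == k by rewrite -(size_map val) def_t size_tuple.
  have uw : uniq w by rewrite -(map_inj_uniq val_inj) def_t.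
  have -> : pattern t = pattern (Tuple sw) by rewrite -def_t pattern_map.
  have cardH : #|H| = k.
    rewrite card_sig -[RHS](size_tuple t) -(card_uniqP ut).
    by apply: eq_card => x; rewrite !inE.
  by rewrite (npat_deck G (u := Tuple sw) uw) // (npat_deck T (u := Tuple sw) uw) // eq_deck.
move=> eq_deck A; case: (posnP (npat G k A)) => [G0|]; last exact: half.
by case: (posnP (npat T k A)) => [->|/half->].
Qed.

(** The entries after [s] form an arbitrary duplicate-free tuple in [D] minus [s]. *)
Lemma card_extensions (I : finType) (D : {set I}) (s : seq I) m :
  uniq s -> {subset s <= D} -> size s <= m ->
  #|[set t : m.-tuple I | [&& uniq t, all (mem D) t & take (size s) t == s]]| =
  (#|D| - size s) ^_ (m - size s).
Proof.
move=> us sD le_m; have [j def_m] : exists j, m = size s + j by exists (m - size s); lia.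
subst m; rewrite addKn.
have -> : #|D| - size s = #|[pred x | (x \notin s) && (x \in D)]|.
  have -> : size s = #|[set x in s]| by rewrite cardsE (card_uniqP us).
  rewrite -(cardsID [set x in s] D) (setIidPr _) ?addKn.
    by apply: eq_card => x; rewrite !inE.
  by apply/subsetP => x; rewrite inE => /sD.
rewrite -card_uniq_tuples -[RHS](card_imset _ (_ : injective (cat_tuple (in_tuple s)))); last first.
  by move=> t1 t2 /(congr1 val) /= /eqP; rewrite eqseq_cat // eqxx => /eqP/val_inj.
apply: eq_card => t; rewrite inE; apply/and3P/imsetP => [[ut Dt /eqP def_s]|[w]].
  have sd : size (drop (size s) t) == j by rewrite size_drop size_tuple addKn.
  have def_t : t = s ++ drop (size s) t :> seq I.
    by rewrite -[LHS](cat_take_drop (size s)) def_s.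
  exists (Tuple sd); last by apply: val_inj => /=.
  rewrite inE /=; move: ut Dt; rewrite {1 2}def_t cat_uniq all_cat.
  move=> /and3P[_ disj ->] /andP[_ Dd]; rewrite andbT.
  apply/allP => x xd; have xD : x \in D := allP Dd _ xd; rewrite /= xD andbT.
  by apply: contra disj => xs; apply/hasP; exists x.
rewrite inE => /andP[Dw uw] ->; split => /=; last by rewrite take_size_cat.
  rewrite cat_uniq us uw andbT; apply/hasPn => x /(allP Dw) /=.
  by case/andP.
rewrite all_cat; apply/andP; split; first by apply/allP.
by apply/allP => x /(allP Dw) /= /andP[].
Qed.

Lemma card_by_prefix (I : finType) i m (P : pred (m.-tuple I)) : i <= m ->
  #|[set u : m.-tuple I | P u]| =
  \sum_(t : i.-tuple I) #|[set u : m.-tuple I | P u && (take i u == t)]|.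
Proof.
move=> le_im; rewrite -sum1_card (eq_bigl P); last by move=> u; rewrite inE.
transitivity (\sum_(u | P u) \sum_(t : i.-tuple I | take i u == t) 1).
  apply: eq_bigr => u _.
  have su : size (take i u) == i by rewrite size_takel ?size_tuple.
  rewrite (big_pred1 (Tuple su)) // => t /=.
rewrite (exchange_big_dep xpredT) //=; apply: eq_bigr => t _.
by rewrite -sum1_card; apply: eq_bigl => u; rewrite inE.
Qed.

(** Kelly's lemma for labelled copies: every labelled copy on [i] vertices extends to the same
    number of duplicate-free [k]-tuples. This number is positive since [k <= #|G|], so it
    cancels. *)
Lemma npat_leq (G T : sgraph) i k : #|G| = #|T| -> k <= #|G| -> i <= k ->
  (forall A, npat G k A = npat T k A) -> forall A, npat G i A = npat T i A.
Proof.
move=> eqn le_k le_i eqk A.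
have count (K : sgraph) : #|[set u : k.-tuple K | uniq u && (pattern (take i u) == A)]| =
    npat K i A * (#|K| - i) ^_ (k - i).
  rewrite (@card_by_prefix _ i) // /npat -sum_nat_const [RHS]big_mkcond /=.
  apply: eq_bigr => t _; rewrite inE; case: ifP => [/andP[ut /eqP pt]|/negP nt].
    have := card_extensions (m := k) (D := setT) ut; rewrite size_tuple cardsT => <- //; last first.
      by move=> x _; rewrite inE.
    apply: eq_card => u; rewrite !inE (_ : all _ _) /=; last first.
      by apply/allP => x _; rewrite /= inE.
    by have [->|_] := eqVneq (take i u) t; rewrite ?andbF // pt eqxx !andbT.
  apply/eqP; rewrite cards_eq0; apply/eqP/setP => u; rewrite !inE.
  apply/negP => /andP[/andP[uu pu] /eqP def_t]; apply: nt.
  by rewrite -def_t pu take_uniq.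
have : #|[set u : k.-tuple G | uniq u && (pattern (take i u) == A)]| =
       #|[set u : k.-tuple T | uniq u && (pattern (take i u) == A)]|.
  apply: (card_fibers (f := fun t : k.-tuple G => pattern t)
                      (h := fun t : k.-tuple T => pattern t)) => [e|u v _ _ eqp].
    exact: eqk.
  by rewrite (pattern_take i eqp).
rewrite !count eqn => /eqP; rewrite eqn_pmul2r ?ffact_gt0; first by move/eqP.
by rewrite -eqn leq_sub2r.
Qed.

(** * Visible balls *)

(* For [b = 0] a root is a vertex [[:: x]], for [b = 1] an edge [[:: x; y]];
   a ball of radius [r] around such a root has diameter at most [2 * r + b]. *)
Definition rooted (G : sgraph) (b : nat) (s : seq G) : bool :=
  (size s == b.+1) && sorted (@adj G) s.

Definition within_root (G : sgraph) (D : {set G}) r (s : seq G) (z : G) : bool :=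
  has (fun x => within D r x z) s.

Definition ball (G : sgraph) r (s : seq G) : {set G} :=
  [set z | within_root setT r s z].

(** The first [b.+1] entries form the root. The walks have to stay in the listed set, so that
    [pattern t] alone decides whether [t] is a star; it does not decide whether [t] exhausts the
    ball. *)
Definition star (G : sgraph) (b r : nat) (t : seq G) : bool :=
  rooted b (take b.+1 t) &&
  all (within_root [set z in t] r (take b.+1 t)) t.

Definition ball_enum (G : sgraph) (b r : nat) (t : seq G) : bool :=
  rooted b (take b.+1 t) && ([set z in t] == ball r (take b.+1 t)).

Lemma within_ball (G : sgraph) r (s : seq G) x z :
  x \in s -> within setT r x z -> within (ball r s) r x z.
Proof.
move=> xs /withinP[p [pp lp sp _]]; apply/withinP; exists p; split=> // w wp.
rewrite inE; apply/hasP; exists x => //.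
case/splitPr: p / wp pp sp {lp} => p1 p2.
rewrite -cat_rcons cat_path size_cat => /andP[pp1 _] sp.
have := within_path pp1; rewrite last_rcons; apply: within_leq.
by apply: leq_trans sp; apply: leq_addr.
Qed.

Lemma ball_enum_star (G : sgraph) b r (t : seq G) : ball_enum b r t -> star b r t.
Proof.
case/andP=> rt /eqP def_t; rewrite /star rt /=; apply/allP => z zt.
have : z \in ball r (take b.+1 t) by rewrite -def_t inE.
rewrite inE => /hasP[x xt wxz]; apply/hasP; exists x => //.
by rewrite def_t; apply: within_ball.
Qed.

Lemma star_sub_ball (G : sgraph) b r (t : seq G) :
  star b r t -> {subset t <= ball r (take b.+1 t)}.
Proof.
case/andP=> _ /allP st z /st /hasP[x xt wxz]; rewrite inE.
by apply/hasP; exists x => //; apply: within_setT wxz.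
Qed.

Lemma star_leq_ball (G : sgraph) b r (t : seq G) :
  uniq t -> star b r t -> size t <= #|ball r (take b.+1 t)|.
Proof.
move=> ut st; rewrite -(card_uniqP ut); apply/subset_leq_card/subsetP.
exact: star_sub_ball st.
Qed.

Lemma within_pattern (G H : sgraph) (x0 : G) (y0 : H) (s : seq G) (t : seq H) r i j :
  pattern s = pattern t -> uniq s -> uniq t -> i < size s -> j < size s ->
  within [set z in s] r (nth x0 s i) (nth x0 s j) =
  within [set z in t] r (nth y0 t i) (nth y0 t j).
Proof.
suff half (K L : sgraph) (a0 : K) (b0 : L) (u : seq K) (v : seq L) :
    pattern u = pattern v -> uniq u -> i < size u -> j < size u ->
    within [set z in u] r (nth a0 u i) (nth a0 u j) ->
    within [set z in v] r (nth b0 v i) (nth b0 v j).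
  move=> eqp us ut lti ltj; apply/idP/idP; apply: half => //.
    by rewrite -(size_pattern eqp).
  by rewrite -(size_pattern eqp).
move=> eqp uu; elim: r i => [|r IHr] i lti ltj /=.
  by rewrite nth_uniq // => /eqP->.
rewrite nth_uniq // => /orP[/eqP->|/existsP[y /and3P[]]]; first by rewrite eqxx.
rewrite inE => /(nthP a0)[m ltm <-] aim wmj.
rewrite -[_ || _]/(within _ r.+1 _ _); apply: (@within_cons _ _ _ _ (nth b0 v m)).
- by rewrite inE mem_nth // -(size_pattern eqp).
- by rewrite -(pattern_nth a0 b0 eqp).
- exact: IHr.
Qed.

Lemma rooted_pattern (G H : sgraph) b (s : seq G) (t : seq H) :
  pattern s = pattern t -> rooted b s -> rooted b t.
Proof.
move=> eqp; rewrite /rooted -(size_pattern eqp) => /andP[-> /=].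
case: s t eqp => [|x s] [|y t] eqp //; try by have := size_pattern eqp.
move=> /(sortedP x) sort_s; apply/(sortedP y) => i.
rewrite -(size_pattern eqp) => lti.
by rewrite -(pattern_nth x y eqp) ?sort_s // ltnW.
Qed.

Lemma within_root_pattern (G H : sgraph) (x0 : G) (y0 : H) b r
    (s : seq G) (t : seq H) i :
  pattern s = pattern t -> uniq s -> uniq t -> i < size s ->
  within_root [set z in s] r (take b s) (nth x0 s i) =
  within_root [set z in t] r (take b t) (nth y0 t i).
Proof.
move=> eqp us ut lti; have eqs := size_pattern eqp.
apply/hasP/hasP; [case=> x /(nthP x0)[j] | case=> x /(nthP y0)[j]];
  rewrite size_take_min leq_min => /andP[ltb ltj] <-; rewrite nth_take // => wj.
  exists (nth y0 t j); last by rewrite -(within_pattern x0 y0 r eqp).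
  by rewrite -(nth_take _ ltb) mem_nth // size_take_min leq_min ltb -eqs.
exists (nth x0 s j); last by rewrite (within_pattern x0 y0 r eqp) // eqs.
by rewrite -(nth_take _ ltb) mem_nth // size_take_min leq_min ltb eqs.
Qed.

Lemma star_pattern (G H : sgraph) b r (s : seq G) (t : seq H) :
  pattern s = pattern t -> uniq s -> uniq t -> star b r s = star b r t.
Proof.
suff half (K L : sgraph) (u : seq K) (v : seq L) :
    pattern u = pattern v -> uniq u -> uniq v -> star b r u -> star b r v.
  by move=> eqp us ut; apply/idP/idP; apply: half.
move=> eqp uu uv /andP[ru /allP su].
rewrite /star (rooted_pattern (pattern_take _ eqp) ru) /=.
apply/allP => z zv; have eqs := size_pattern eqp.
have [x0 _] : exists x0 : K, true.
  by case: u {su} ru {eqp eqs uu} => [|x0 u] //= _; exists x0.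
have lti : index z v < size u by rewrite eqs index_mem.
rewrite -(nth_index z zv) -(within_root_pattern x0 z b.+1 r eqp) //.
by apply: su; apply: mem_nth.
Qed.

(** A star [t] lies in the ball of its root. The [m - i] missing vertices can be appended in any
    order, and [t] is recovered as a prefix of the resulting enumeration. *)
Lemma card_ball_extend (G : sgraph) b r i m (R : pred (seq G)) :
  b < i <= m -> (forall t, R t -> uniq t /\ star b r t) ->
  #|[set t : i.-tuple G | R t && (#|ball r (take b.+1 t)| == m)]| * (m - i)`! =
  #|[set u : m.-tuple G | uniq u && ball_enum b r u && R (take i u)]|.
Proof.
move=> /andP[lt_bi le_im] Rstar.
rewrite (@card_by_prefix _ i m (fun u => uniq u && ball_enum b r u && R (take i u))) //.
rewrite -sum_nat_const [LHS]big_mkcond /=; apply: eq_bigr => t _.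
rewrite inE; case: ifP => [/andP[Rt /eqP cardB]|/negP nt]; last first.
  apply/esym/eqP; rewrite cards_eq0; apply/eqP/setP => u; rewrite !inE.
  apply/negP => /andP[/andP[/andP[uu /andP[_ /eqP def_u]] Ru] /eqP def_t]; apply: nt.
  rewrite -def_t Ru take_takel // -def_u cardsE (card_uniqP uu) size_tuple.
  exact: eqxx.
have [ut st] := Rstar t Rt.
have := card_extensions (m := m) ut (star_sub_ball st).
rewrite size_tuple cardB ffactnn => <- //; apply: eq_card => u; rewrite !inE.
case: (eqVneq (take i u) t) => [def_t|]; rewrite ?andbF // def_t Rt !andbT.
case uu : (uniq u) => //=.
have eqtake : take b.+1 u = take b.+1 t by rewrite -def_t take_takel.
rewrite /ball_enum eqtake; case/andP: st => -> _ /=.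
rewrite eqEcard cardB cardsE (card_uniqP uu) size_tuple leqnn andbT.
by apply/allP/subsetP => sub x; [rewrite inE|move=> xu]; apply: sub; rewrite // inE.
Qed.

(** Downward induction on [i]. The stars with pattern [A] are classified by the size [j] of the ball
    around their root. The total is known, the part with [j > i] comes from larger balls by
    induction, and what remains, [j = i], are the stars that exhaust their ball. *)
Lemma ball_enum_count (G T : sgraph) b r k :
  #|G| = #|T| -> k <= #|G| -> (forall A, npat G k A = npat T k A) ->
  (forall s : seq G, rooted b s -> #|ball r s| <= k) ->
  (forall s : seq T, rooted b s -> #|ball r s| <= k) ->
  forall i, b < i <= k -> forall A,
  #|[set t : i.-tuple G | uniq t && ball_enum b r t && (pattern t == A)]| =
  #|[set t : i.-tuple T | uniq t && ball_enum b r t && (pattern t == A)]|.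
Proof.
move=> eqn le_k eqk ballG ballT i.
have [m le_m] := ubnP (k - i); elim: m i le_m => // m IHm i lt_m /andP[lt_bi le_ik] A.
have Nstar (K : sgraph) (t : i.-tuple K) :
    uniq t && ball_enum b r t -> star b r t by case/andP=> _ /ball_enum_star.
have no_star (K : sgraph) : (forall t : i.-tuple K, uniq t -> star b r t -> pattern t != A) ->
    #|[set t : i.-tuple K | uniq t && ball_enum b r t && (pattern t == A)]| = 0.
  move=> nst; apply/eqP; rewrite cards_eq0; apply/eqP/setP => t; rewrite !inE.
  apply/negP => /andP[/andP[ut bt] pt]; have := nst t ut (ball_enum_star bt).
  by rewrite pt.
pose starA (K : sgraph) := [exists t : i.-tuple K, [&& uniq t, star b r t & pattern t == A]].
have [|no_starA] := boolP (starA G || starA T); last first.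
  rewrite !no_star // => t ut st; apply: contra no_starA => pt; rewrite /starA.
    by apply/orP; right; apply/existsP; exists t; rewrite ut st.
  by apply/orP; left; apply/existsP; exists t; rewrite ut st.
(* The pattern decides whether a tuple is a star, so one star with pattern [A] makes every
   duplicate-free tuple with pattern [A] a star. *)
move=> starGT; have all_star (K : sgraph) (t : seq K) :
    uniq t -> pattern t == A -> star b r t.
  move=> ut /eqP pt; case/orP: starGT => /existsP[t' /and3P[ut' st' /eqP pt']];
    by rewrite (star_pattern b r (etrans pt (esym pt'))).
have split_count (K : sgraph) : (forall s : seq K, rooted b s -> #|ball r s| <= k) ->
  npat K i A = #|[set t : i.-tuple K | uniq t && ball_enum b r t && (pattern t == A)]| +
    \sum_(i.+1 <= j < k.+1) #|[set t : i.-tuple K | uniq t && (pattern t == A) &&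
                              (#|ball r (take b.+1 t)| == j)]|.
  move=> ballK.
  have -> : npat K i A = \sum_(i <= j < k.+1) #|[set t : i.-tuple K |
      uniq t && (pattern t == A) && (#|ball r (take b.+1 t)| == j)]|.
    rewrite /npat -sum1_card (eq_bigr (fun t : i.-tuple K => \sum_(i <= j < k.+1 |
        #|ball r (take b.+1 t)| == j) 1)); last first.
      move=> t /[!inE]/andP[ut pt]; have st := all_star _ _ ut pt.
      rewrite big_mkcond (bigD1_seq #|ball r (take b.+1 t)|) ?iota_uniq //=.
        by rewrite eqxx big1 // => j; rewrite eq_sym => /negPf->.
      rewrite mem_index_iota ltnS ballK ?andbT; last by case/andP: st.
      by have := star_leq_ball ut st; rewrite size_tuple.
    rewrite (exchange_big_dep xpredT) //=; apply: eq_bigr => j _.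
    by rewrite -sum1_card; apply: eq_bigl => t; rewrite !inE.
  rewrite big_ltn ?ltnS //; congr (_ + _); apply: eq_card => t; rewrite !inE.
  case ut : (uniq t) => //=; case: (boolP (pattern t == A)) => pt; rewrite ?andbF // andbT.
  have st := all_star _ _ ut pt; rewrite /ball_enum; case/andP: (st) => -> _ /=.
  have card_t : #|[set z in t]| = i by rewrite cardsE (card_uniqP ut) size_tuple.
  rewrite eqEcard card_t (_ : _ \subset _); last first.
    by apply/subsetP => x; rewrite inE; apply: star_sub_ball.
  by have := star_leq_ball ut st; rewrite size_tuple /= eqn_leq => ->; rewrite andbT.
have := npat_leq eqn le_k le_ik eqk A; rewrite !split_count //.
suff -> : \sum_(i.+1 <= j < k.+1) #|[set t : i.-tuple G | uniq t && (pattern t == A) &&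
              (#|ball r (take b.+1 t)| == j)]| =
          \sum_(i.+1 <= j < k.+1) #|[set t : i.-tuple T | uniq t && (pattern t == A) &&
              (#|ball r (take b.+1 t)| == j)]| by move/addIn.
apply: eq_big_nat => j /andP[lt_ij]; rewrite ltnS => le_jk; apply/eqP.
(* Multiplying by the factorial of [j - i] turns both sides into counts of ball enumerations of size
   [j > i]. *)
rewrite -(eqn_pmul2r (fact_gt0 (j - i))); apply/eqP.
have bij : b < i <= j by rewrite lt_bi ltnW.
rewrite (@card_ball_extend G b r i j (fun t => uniq t && (pattern t == A))) //; last first.
  by move=> t /andP[ut pt]; split=> //; apply: all_star.
rewrite (@card_ball_extend T b r i j (fun t => uniq t && (pattern t == A))) //; last first.
  by move=> t /andP[ut pt]; split=> //; apply: all_star.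
apply: (card_fibers (f := fun t : j.-tuple G => pattern t)
                    (h := fun t : j.-tuple T => pattern t)) => [e|u v].
  by apply: IHm; lia.
move=> /andP[uu _] /andP[uv _] eqp.
by rewrite !take_uniq // (pattern_take i eqp).
Qed.

(* The multiset of isomorphism types of balls is determined by the deck,
   provided that no ball has more than [k] vertices. *)
Lemma visible_roots (G T : sgraph) b r k (P : pred (seq G)) (Q : pred (seq T)) :
  #|G| = #|T| -> k <= #|G| -> (forall A, npat G k A = npat T k A) ->
  (forall s : seq G, rooted b s -> #|ball r s| <= k) ->
  (forall s : seq T, rooted b s -> #|ball r s| <= k) -> b <= 1 ->
  (forall (s : seq G) (t : seq T), uniq s -> uniq t -> ball_enum b r s ->
     ball_enum b r t -> pattern s = pattern t ->
     P (take b.+1 s) = Q (take b.+1 t)) ->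
  #|[set s : b.+1.-tuple G | rooted b s && P s]| =
  #|[set s : b.+1.-tuple T | rooted b s && Q s]|.
Proof.
move=> eqn le_k eqk ballG ballT le_b1 eqPQ.
(* A root alone is a star on [b.+1] vertices, so [card_ball_extend] applies to it; [b <= 1] makes
   its entries distinct. *)
have root_star (K : sgraph) (s : seq K) : rooted b s -> uniq s /\ star b r s.
  move=> rs; split.
    case/andP: rs => /eqP ss; have: size s <= 2 by rewrite ss.
    case: s {ss} => [|x [|y [|z s]]] //= _; rewrite !andbT inE => axy.
    by apply: contraTneq axy => ->; rewrite adj_irrefl.
  have /andP[/eqP ss _] := rs; rewrite /star take_oversize ?ss // rs /=.
  by apply/allP => x xs; apply/hasP; exists x => //; apply: within0.
have split_count (K : sgraph) (R : pred (seq K)) :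
    (forall s : seq K, rooted b s -> #|ball r s| <= k) ->
    #|[set s : b.+1.-tuple K | rooted b s && R s]| =
    \sum_(b.+1 <= j < k.+1) #|[set s : b.+1.-tuple K | (rooted b s && R s) &&
                               (#|ball r (take b.+1 s)| == j)]|.
  move=> ballK; rewrite -sum1_card (eq_bigr (fun t : b.+1.-tuple K =>
      \sum_(b.+1 <= j < k.+1 | #|ball r (take b.+1 t)| == j) 1)); last first.
    move=> t /[!inE]/andP[rt _]; have [ut st] := root_star _ _ rt.
    rewrite big_mkcond (bigD1_seq #|ball r (take b.+1 t)|) ?iota_uniq //=.
      by rewrite eqxx big1 // => j; rewrite eq_sym => /negPf->.
    rewrite mem_index_iota ltnS ballK ?andbT; last by case/andP: st.
    by have := star_leq_ball ut st; rewrite size_tuple.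
  rewrite (exchange_big_dep xpredT) //=; apply: eq_bigr => j _.
  by rewrite -sum1_card; apply: eq_bigl => t; rewrite !inE.
rewrite !split_count //; apply: eq_big_nat => j /andP[lt_bj]; rewrite ltnS => le_jk.
apply/eqP; rewrite -(eqn_pmul2r (fact_gt0 (j - b.+1))); apply/eqP.
have bj : b < b.+1 <= j by rewrite ltnSn.
rewrite (@card_ball_extend G b r b.+1 j (fun t => rooted b t && P t)) //; last first.
  by move=> t /andP[/root_star].
rewrite (@card_ball_extend T b r b.+1 j (fun t => rooted b t && Q t)) //; last first.
  by move=> t /andP[/root_star].
apply: (card_fibers (f := fun t : j.-tuple G => pattern t)
                    (h := fun t : j.-tuple T => pattern t)) => [e|u v].
  by apply: (ball_enum_count eqn le_k eqk ballG ballT); rewrite lt_bj.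
move=> /andP[uu bu] /andP[uv bv] eqp; rewrite (eqPQ u v) //.
by case/andP: bu => -> _; case/andP: bv => -> _.
Qed.

(** * Legs and arcs seen inside balls *)

Arguments within : simpl never.

Lemma in_ball1 (G : sgraph) r (x z : G) : (z \in ball r [:: x]) = within setT r x z.
Proof. by rewrite inE /within_root /= orbF. Qed.

Lemma in_ball2 (G : sgraph) r (x y z : G) :
  (z \in ball r [:: x; y]) = within setT r x z || within setT r y z.
Proof. by rewrite inE /within_root /= orbF. Qed.

(** The branches at [x] that reach depth [t.+1], where a neighbour of [x] has depth 1. *)
Definition legs (G : sgraph) (D : {set G}) t (x : G) : nat :=
  #|[set y in D | arc_to D t x y]|.

Lemma arc_to_pattern (G H : sgraph) (x0 : G) (y0 : H) (s : seq G) (t : seq H) r i j :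
  pattern s = pattern t -> uniq s -> uniq t -> i < size s -> j < size s ->
  arc_to [set z in s] r (nth x0 s i) (nth x0 s j) =
  arc_to [set z in t] r (nth y0 t i) (nth y0 t j).
Proof.
move=> eqp us ut lti ltj; have eqs := size_pattern eqp.
rewrite /arc_to (pattern_nth x0 y0 eqp) //; congr (_ && _).
apply/exists_inP/exists_inP => -[z]; rewrite inE.
  move=> /(nthP x0)[m ltm <-] wz; exists (nth y0 t m); first by rewrite inE mem_nth -?eqs.
  by rewrite -!(within_pattern x0 y0 r eqp).
move=> /(nthP y0)[m]; rewrite -eqs => ltm <- wz.
exists (nth x0 s m); first by rewrite inE mem_nth.
by rewrite !(within_pattern x0 y0 r eqp).
Qed.

Lemma card_set_seq (I : finType) (x0 : I) (s : seq I) (P : pred I) :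
  uniq s -> #|[set y in [set z in s] | P y]| =
            #|[set i : 'I_(size s) | P (nth x0 s i)]|.
Proof.
move=> us; rewrite -(card_imset _ (_ : injective (fun i : 'I_(size s) => nth x0 s i))).
  apply: eq_card => y; rewrite !inE; apply/andP/imsetP => [[ys Py]|[i]].
    have lti : index y s < size s by rewrite index_mem.
    by exists (Ordinal lti); rewrite ?inE /= nth_index.
  by rewrite inE => Pi ->; rewrite mem_nth.
by move=> i j /eqP; rewrite nth_uniq // => /eqP/val_inj.
Qed.

Lemma legs_pattern (G H : sgraph) (x0 : G) (y0 : H) (s : seq G) (t : seq H) r i :
  pattern s = pattern t -> uniq s -> uniq t -> i < size s ->
  legs [set z in s] r (nth x0 s i) = legs [set z in t] r (nth y0 t i).
Proof.
move=> eqp us ut lti; rewrite /legs (card_set_seq x0) // (card_set_seq y0) //.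
have eqs := size_pattern eqp.
rewrite -(card_imset _ (@cast_ord_inj _ _ eqs)); apply: eq_card => j; rewrite inE.
apply/imsetP/idP => [[m]|arcj].
  by rewrite inE (arc_to_pattern x0 y0 r eqp us ut lti (ltn_ord m)) => arcm ->.
have ltj : j < size s by rewrite eqs.
exists (Ordinal ltj); last exact: val_inj.
by rewrite inE /= (arc_to_pattern x0 y0 r eqp).
Qed.

Lemma within_local (G : sgraph) (D : {set G}) t y z :
  (forall w, within setT t y w -> w \in D) -> within D t y z = within setT t y z.
Proof.
move=> subD; apply/idP/idP; first exact: within_setT.
move=> wyz; apply: within_mono (leqnn t) (within_ball (mem_head y [::]) wyz).
by apply/subsetP => w; rewrite in_ball1 => /subD.
Qed.

Lemma arc_to_local (G : sgraph) (D : {set G}) t x y :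
  (forall w, within setT t x w -> w \in D) ->
  (forall w, within setT t y w -> w \in D) ->
  arc_to D t x y = arc_to setT t x y.
Proof.
move=> xD yD; rewrite /arc_to; congr (_ && _).
apply/exists_inP/exists_inP => -[z zD]; rewrite ?(within_local _ xD) ?(within_local _ yD).
  by move=> wz; exists z; rewrite ?inE.
by move=> /andP[wz nz]; exists z; rewrite ?(within_local _ xD) ?(within_local _ yD) ?yD ?wz.
Qed.

Lemma legs_local (G : sgraph) t (x : G) :
  legs (ball t.+1 [:: x]) t x = legs setT t x.
Proof.
apply: eq_card => y; rewrite in_set in_ball1 in_set in_setT /=.
have [axy|/negPf naxy] := boolP (adj x y); last by rewrite /arc_to naxy andbF.
rewrite (within_cons (in_setT y) axy (within0 _ _ _)) /=.
apply: arc_to_local => w ww; rewrite in_ball1; first exact: within_leq ww.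
exact: within_cons (in_setT y) axy ww.
Qed.

Lemma arc_to_edge_local (G : sgraph) t (x y : G) :
  arc_to (ball t [:: x; y]) t x y = arc_to setT t x y.
Proof.
by apply: arc_to_local => w ww; rewrite in_ball2 ww ?orbT.
Qed.

Lemma ball2C (G : sgraph) t (x y : G) : ball t [:: x; y] = ball t [:: y; x].
Proof. by apply/setP => z; rewrite !in_ball2 orbC. Qed.

Lemma card_tuple1 (I : finType) (P : pred I) (R : pred (seq I)) :
  (forall x, R [:: x] = P x) -> #|[set s : 1.-tuple I | R s]| = #|[set x | P x]|.
Proof.
move=> RP; rewrite -[RHS](card_imset _ (_ : injective (fun x : I => [tuple x]))).
  apply: eq_card => s; rewrite inE; apply/idP/imsetP => [Rs|[x]].
    case/tupleP: s Rs => x s; rewrite tuple0 => Rx; exists x => //.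
    by rewrite inE -RP.
  by rewrite inE -RP => Rx ->.
by move=> x y [].
Qed.

Lemma card_tuple2 (I : finType) (P : I -> I -> bool) (R : pred (seq I)) :
  (forall x y, R [:: x; y] = P x y) ->
  #|[set s : 2.-tuple I | R s]| = #|[set p | P p.1 p.2]|.
Proof.
move=> RP; rewrite -[RHS](card_imset _ (_ : injective (fun p : I * I => [tuple p.1; p.2]))).
  apply: eq_card => s; rewrite inE; apply/idP/imsetP => [Rs|[p]].
    case/tupleP: s Rs => x s; case/tupleP: s => y s; rewrite tuple0 => Rx.
    by exists (x, y); rewrite ?inE -?RP.
  by rewrite inE -RP => Rx ->.
by move=> [x1 x2] [y1 y2] [/= -> ->].
Qed.

(** The ball of radius [t.+1] around [x] shows the legs of [x], by [legs_local], so this is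
    [visible_roots] with [b = 0]. *)
Lemma visible_vertices (G T : sgraph) t k (P : pred nat) :
  #|G| = #|T| -> k <= #|G| -> (forall A, npat G k A = npat T k A) ->
  (forall x : G, #|ball t.+1 [:: x]| <= k) ->
  (forall x : T, #|ball t.+1 [:: x]| <= k) ->
  #|[set x : G | P (legs setT t x)]| = #|[set x : T | P (legs setT t x)]|.
Proof.
move=> eqn le_k eqk ballG ballT.
pose R (K : sgraph) (s : seq K) := if s is x :: _ then P (legs setT t x) else false.
rewrite -(@card_tuple1 G _ (fun s => rooted 0 s && R G s)) //.
rewrite -(@card_tuple1 T _ (fun s => rooted 0 s && R T s)) //.
apply: (visible_roots eqn le_k eqk (r := t.+1)) => //.
- by move=> [|x [|y s]].
- by move=> [|x [|y s]].
move=> [|x s] [|y u] // us uu /andP[_ /eqP bs] /andP[_ /eqP bu] eqp.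
rewrite /= !take0 in bs bu *.
rewrite -!legs_local -bs -bu.
by congr P; apply: (legs_pattern x y t (i := 0) eqp us uu).
Qed.

(** The walks that decide both arcs stay in the ball of radius [t] around the edge, so this is
    [visible_roots] with [b = 1]. Each edge is counted in both orientations. *)
Lemma visible_edges (G T : sgraph) t k (P : bool -> bool -> bool) :
  #|G| = #|T| -> k <= #|G| -> (forall A, npat G k A = npat T k A) ->
  (forall x y : G, adj x y -> #|ball t [:: x; y]| <= k) ->
  (forall x y : T, adj x y -> #|ball t [:: x; y]| <= k) ->
  #|[set p : G * G | adj p.1 p.2 && P (arc_to setT t p.1 p.2) (arc_to setT t p.2 p.1)]| =
  #|[set p : T * T | adj p.1 p.2 && P (arc_to setT t p.1 p.2) (arc_to setT t p.2 p.1)]|.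
Proof.
move=> eqn le_k eqk ballG ballT.
pose R (K : sgraph) (s : seq K) :=
  if s is [:: x, y & _] then P (arc_to setT t x y) (arc_to setT t y x) else false.
have root2 (K : sgraph) x y : adj x y && P (arc_to setT t x y) (arc_to setT t y x) =
    rooted 1 [:: x; y] && R K [:: x; y] by rewrite /rooted /= andbT.
rewrite -(@card_tuple2 G (fun x y => adj x y &&
    P (arc_to setT t x y) (arc_to setT t y x)) (fun s => rooted 1 s && R G s)) => [|x y]; last exact/esym/root2.
rewrite -(@card_tuple2 T (fun x y => adj x y &&
    P (arc_to setT t x y) (arc_to setT t y x)) (fun s => rooted 1 s && R T s)) => [|x y]; last exact/esym/root2.
apply: (visible_roots eqn le_k eqk (r := t)) => //.
- by move=> [|x [|y [|z s]]] // /andP[_ /= /andP[axy _]]; apply: ballG.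
- by move=> [|x [|y [|z s]]] // /andP[_ /= /andP[axy _]]; apply: ballT.
move=> [|x [|x' s]] [|y [|y' u]] // us uu /andP[r1 /eqP bs] /andP[r2 /eqP bu] eqp //=.
rewrite /= !take0 in bs bu *.
rewrite -(arc_to_edge_local t x x') -(arc_to_edge_local t x' x) (ball2C _ x') -bs.
rewrite -(arc_to_edge_local t y y') -(arc_to_edge_local t y' y) (ball2C _ y') -bu.
congr P; first exact: (arc_to_pattern x y t (i := 0) (j := 1) eqp us uu).
exact: (arc_to_pattern x y t (i := 1) (j := 0) eqp us uu).
Qed.

(** * Edge counts *)

(** Ordered pairs, hence twice the number of edges. *)
Definition arcs (G : sgraph) : nat := #|[set p : G * G | adj p.1 p.2]|.

Lemma npat2_arcs (G T : sgraph) :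
  (forall A, npat G 2 A = npat T 2 A) -> arcs G = arcs T.
Proof.
move=> eq2; pose R (K : sgraph) (s : seq K) := if s is [:: x, y & _] then adj x y else false.
have arcsE (K : sgraph) : arcs K = #|[set t : 2.-tuple K | uniq t && R K t]|.
  rewrite (@card_tuple2 K (fun x y => adj x y) (fun t => uniq t && R K t)) // => x y /=.
  by rewrite inE andbT; case: eqVneq => [->|] //=; rewrite adj_irrefl.
rewrite !arcsE; apply: (card_fibers (f := fun t : 2.-tuple G => pattern t)
                      (h := fun t : 2.-tuple T => pattern t)) => [e|u v _ _].
  exact: eq2.
case/tupleP: u => x u; case/tupleP: u => x' u; case/tupleP: v => y v.
case/tupleP: v => y' v => eqp.
exact: (pattern_nth x y (i := 0) (j := 1) eqp).
Qed.

Lemma shortest_cycle (G : sgraph) :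
  acyclic G \/ exists c, [/\ ucycle (@adj G) c, 2 < size c &
    forall c', ucycle (@adj G) c' -> 2 < size c' -> size c <= size c'].
Proof.
pose P m := (2 < m) && [exists c : m.-tuple G, ucycleb (@adj G) c].
have Psize c : ucycle (@adj G) c -> 2 < size c -> P (size c).
  by move=> cc lt2; rewrite /P lt2; apply/existsP; exists (in_tuple c).
case: (boolP [exists m : 'I_#|G|.+1, P m]) => [/existsP[m Pm]|noP].
  have exP : exists m, P m by exists m.
  case: (ex_minnP exP) => i /andP[lt2 /existsP[c cc]] min_i; right; exists c.
  by rewrite size_tuple; split=> // c' cc' lt2'; apply: min_i; apply: Psize.
left=> c lt2 cc; case/existsP: noP.
have lt_c : size c < #|G|.+1.
  by rewrite ltnS; case/andP: cc => _ /card_uniqP <-; apply: max_card.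
by exists (Ordinal lt_c); apply: Psize.
Qed.

(** Every arc leads away from or towards the root of its component. A vertex is the head of at most
    one arc leading away, by [closer_unique], and a root is the head of none. Reversal matches the
    two kinds. *)
Lemma acyclic_arcs (G : sgraph) (R : {set G}) :
  acyclic G -> {in R, forall x, root (@adj G) x = x} -> arcs G <= 2 * (#|G| - #|R|).
Proof.
move=> acG rootR; pose rho := root (@adj G).
have symG := @connect_adj_sym G; have crho := connect_root (@adj G).
pose down := [set p : G * G | adj p.1 p.2 && (dist p.2 (rho p.2) == (dist p.1 (rho p.1)).+1)].
pose up := [set p : G * G | adj p.1 p.2 && (dist p.1 (rho p.1) == (dist p.2 (rho p.2)).+1)].
have eq_rho x y : adj x y -> rho x = rho y.
  by move=> axy; apply/(rootP symG)/connect1.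
have le_down : #|down| <= #|G| - #|R|.
  rewrite -(@card_in_imset _ _ snd); last first.
    move=> [x y] [x' y'] /[!inE]/= /andP[axy /eqP exy] /andP[axy' /eqP exy'] eqy.
    rewrite -{}eqy in axy' exy' *; congr (_, _).
    apply: (@closer_unique G (dist x (rho x)) y x x' (rho y)) => //.
    - by rewrite adj_sym.
    - by rewrite adj_sym.
    - by rewrite -leq_dist -(eq_rho _ _ axy) ?crho.
    - rewrite -leq_dist -(eq_rho _ _ axy') ?crho //.
      by move: exy'; rewrite exy => -[->].
    - by rewrite -leq_dist ?crho // exy ltnn.
  have -> : #|G| - #|R| = #|~: R| by rewrite -(cardsC R) addKn.
  apply: subset_leq_card; apply/subsetP => y.
  case/imsetP=> -[x z] /[!inE]/= /andP[axz /eqP exz] ->.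
  by apply/negP => /rootR ez; move: exz; rewrite {1}/rho ez dist_refl.
have eq_up : #|up| = #|down|.
  have swap_inj : injective (fun p : G * G => (p.2, p.1)) by move=> [a b] [a' b'] [-> ->].
  rewrite -[RHS](card_imset _ swap_inj); apply: eq_card => -[x y].
  apply/idP/imsetP => [|[[x' y']] /[!inE]/= /andP[axy exy] [-> ->]]; last first.
    by rewrite adj_sym axy.
  by rewrite inE /= => /andP[axy exy]; exists (y, x); rewrite // inE /= adj_sym axy.
apply: (@leq_trans #|up :|: down|); last first.
  by apply: leq_trans (leq_card_setU _ _) _; rewrite eq_up; lia.
apply: subset_leq_card; apply/subsetP => -[x y]; rewrite !inE /= => axy.
rewrite axy /= (eq_rho _ _ axy).
have := dist_adj_cases acG axy (_ : connect _ x (rho y)).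
by rewrite -(eq_rho _ _ axy) crho => -[] // ->; rewrite eqxx ?orbT.
Qed.

(** [D] and [U] are the two orientations of a breadth-first tree with root [v]. On a cycle, the
    vertex [x] farthest from [v] has a cycle edge that does not lead to [par x]. It does not lead to
    a child of [x] either, which would be farther, so it is not a tree edge. *)
Lemma connected_arcs (G : sgraph) : connected G ->
  2 * (#|G| - 1) <= arcs G /\
  (forall c, ucycle (@adj G) c -> 2 < size c -> 2 * (#|G| - 1) < arcs G).
Proof.
case=> /card_gt0P[v _] conG.
pose par x := odflt x [pick y | adj x y && (dist x v == (dist y v).+1)].
have parP x : x != v -> adj x (par x) /\ dist x v = (dist (par x) v).+1.
  move=> xv; rewrite /par; case: pickP => [y /andP[axy /eqP ->] //|nopar].
  have wx : within setT (dist x v) x v by rewrite -leq_dist.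
  case/withinP: wx => -[|y p] [/= pp lp sp _]; first by rewrite lp eqxx in xv.
  case/andP: pp => axy pp; have := nopar y; rewrite axy /= => /eqP[].
  apply/eqP; rewrite eqn_leq (dist_adj axy (conG _ _)) /=.
  by apply: leq_trans sp; rewrite ltnS leq_dist // -lp within_path.
have parv : par v = v.
  rewrite /par; case: pickP => // y /andP[_ /eqP]; move/eqP.
  by rewrite dist_refl.
pose D := [set (x, par x) | x in ~: [set v]]; pose U := [set (par x, x) | x in ~: [set v]].
have cardD : #|D| = #|G| - 1 by rewrite card_imset ?cardsC1 ?subn1 // => x y [].
have cardU : #|U| = #|G| - 1 by rewrite card_imset ?cardsC1 ?subn1 // => x y [].
have disjDU : [disjoint D & U].
  rewrite -setI_eq0; apply/eqP/setP => -[x y]; rewrite !inE; apply/negP.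
  case/andP=> /imsetP[z /[!inE]/parP[_ dz] [-> ->]] /imsetP[w /[!inE]/parP[_ dw] [ez ew]].
  have := congr1 (fun q => dist q v) ez; have /= := congr1 (fun q => dist q v) ew.
  by move: dz dw; lia.
have card_DU : #|D :|: U| = 2 * (#|G| - 1).
  by rewrite cardsU disjoint_setI0 // cards0 cardD cardU; lia.
have sub_DU : D :|: U \subset [set p : G * G | adj p.1 p.2].
  apply/subsetP => p; rewrite in_setU; case/orP=> /imsetP[x /[!inE]/parP[ax _] ->] //=.
  by rewrite adj_sym.
split; first by rewrite -card_DU subset_leq_card.
move=> c cc lt2; rewrite -card_DU; apply: proper_card; rewrite properE sub_DU /=.
have [x xc max_x] : exists2 x, x \in c & forall y, y \in c -> dist y v <= dist x v.
  case: c cc lt2 => // a c _ _.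
  by case: (@arg_maxnP _ a (mem (a :: c)) (fun y => dist y v) (mem_head a c)) => x xc mx; exists x.
have [i s def_s] := rot_to xc.
have ccs : ucycle (@adj G) (x :: s) by rewrite -def_s rot_ucycle.
have ss : 1 < size s by have := size_rot i c; rewrite def_s /= -ltnS => ->.
have sub_c y : y \in s -> y \in c by move=> ys; rewrite -(mem_rot i) def_s inE ys orbT.
case: s ss ccs sub_c {def_s} => [|y1 [|y2 s]] //= _ ccs sub_c.
pose z := last y2 s.
have ax1 : adj x y1 by case/andP: ccs => /= /andP[].
have axz : adj x z.
  by case/andP: ccs => /= /andP[_ /andP[_]]; rewrite rcons_path adj_sym => /andP[].
have zs : z \in y2 :: s by apply: mem_last.
have neq1z : y1 != z.
  case/andP: ccs => _ /= /andP[_ /andP[y1s _]]; apply: contraNneq y1s => ->.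
  by rewrite zs.
have notDU y : adj x y -> y \in c -> y != par x -> (x, y) \notin D :|: U.
  move=> axy yc ypx; rewrite in_setU; apply/norP; split; apply/imsetP => -[w].
    by move=> _ [ew ey]; rewrite ey ew eqxx in ypx.
  rewrite !inE => /parP[_ dw] [ex ey]; have := max_x y yc.
  by rewrite ey dw -ex ltnn.
apply/subsetPn; have [e1|ne1] := eqVneq y1 (par x); last first.
  by exists (x, y1); [rewrite inE | apply: notDU => //; apply: sub_c; rewrite mem_head].
exists (x, z); first by rewrite inE.
apply: notDU => //; last by rewrite -e1 eq_sym.
by apply: sub_c; rewrite inE zs orbT.
Qed.

Lemma tree_arcs (T : sgraph) : is_tree T -> arcs T = 2 * (#|T| - 1).
Proof.
case=> conT acT; apply/eqP; rewrite eqn_leq (connected_arcs conT).1 andbT.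
case: (conT) => /card_gt0P[v _] _.
have := acyclic_arcs (R := [set root (@adj T) v]) acT; rewrite cards1; apply.
by move=> x; rewrite inE => /eqP->; apply: root_root; apply: connect_adj_sym.
Qed.

(** A connected graph with a cycle has too many edges and a disconnected forest too few. So a graph
    that is not a tree is disconnected and has a cycle, and one of two unconnected vertices is not
    connected to a shortest cycle. *)
Lemma tree_dichotomy (G : sgraph) : 0 < #|G| -> arcs G = 2 * (#|G| - 1) ->
  is_tree G \/
  exists (c : seq G) (z : G), [/\ ucycle (@adj G) c, 2 < size c,
    forall c', ucycle (@adj G) c' -> 2 < size c' -> size c <= size c' &
    forall x, x \in c -> ~~ connect (@adj G) z x].
Proof.
move=> n_gt0 arcsG.
have [/forallP conG|] := boolP [forall x : G, forall y : G, connect (@adj G) x y].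
  left; split; first by split=> // x y; have /forallP := conG x.
  have conn : connected G by split=> // x y; have /forallP := conG x.
  move=> c lt2 cc; have := (connected_arcs conn).2 c cc lt2.
  by rewrite arcsG ltnn.
rewrite negb_forall => /existsP[x0]; rewrite negb_forall => /existsP[x1 nc].
have symG := @connect_adj_sym G.
have [acG|[c [cc lt2 min_c]]] := shortest_cycle G; last first.
  right; have [a ac] : exists a, a \in c by case: (c) lt2 => // a s _; exists a; rewrite mem_head.
  have con_c x : x \in c -> connect (@adj G) a x.
    move=> xc; have [i s def_s] := rot_to ac.
    have /andP[/= pc _] : ucycle (@adj G) (a :: s) by rewrite -def_s rot_ucycle.
    have: x \in a :: s by rewrite -def_s mem_rot.
    rewrite inE => /predU1P[->//|xs]; case/splitPr: s / xs pc {def_s} => p1 p2.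
    rewrite rcons_cat -cat_rcons cat_path => /andP[pp _].
    by apply/connectP; exists (rcons p1 x); rewrite ?last_rcons.
  have [ca0|nca0] := boolP (connect (@adj G) a x0).
    exists c, x1; split=> // x xc; apply: contra nc => c1x.
    rewrite symG; apply: connect_trans c1x _; rewrite symG in ca0.
    by rewrite symG; apply: connect_trans ca0 (con_c x xc).
  exists c, x0; split=> // x xc; apply: contra nca0 => c0x.
  by apply: connect_trans (con_c x xc) _; rewrite symG.
have neq_root : root (@adj G) x0 != root (@adj G) x1.
  by apply: contra nc => /eqP/(rootP symG).
have rootR : {in [set root (@adj G) x0; root (@adj G) x1], forall x, root (@adj G) x = x}.
  by move=> x; rewrite !inE => /orP[]/eqP->; apply: root_root.
have := acyclic_arcs acG rootR; rewrite cards2 neq_root arcsG.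
have : 1 < #|G|.
  apply: leq_trans (max_card [set root (@adj G) x0; root (@adj G) x1]).
  by rewrite cards2 neq_root.
lia.
Qed.

(** * Small components *)

Definition component (G : sgraph) (z : G) : {set G} := [set x | connect (@adj G) z x].

(** The path from [y] to the far vertex [z] has at least [s] edges, and each of its vertices is
    closer to [y] than to [x], or else [x] would reach [z] in [s] steps. *)
Lemma arc_to_side (G : sgraph) s (x y : G) : arc_to setT s x y ->
  s < #|[set w in component x | dist y w < dist x w]|.
Proof.
case/andP=> axy /exists_inP[z _ /andP[/within_uniq[p [pp lp sp _ up]] nxz]].
have ge_s : s <= size p.
  rewrite leqNgt; apply: contra nxz => lt_p; apply: within_leq lt_p _.
  by apply: within_cons (in_setT y) axy _; rewrite -lp within_path.
apply: (@leq_trans (size (y :: p))) => //.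
rewrite -(card_uniqP up); apply/subset_leq_card/subsetP => w wp.
case/splitPl: p / wp pp lp sp {up ge_s} => p1 p2 lp1.
rewrite cat_path last_cat size_cat lp1 => /andP[pp1 pp2] lp2 sp.
have cyw : connect (@adj G) y w by apply/connectP; exists p1.
have cxw : connect (@adj G) x w by apply: connect_trans (connect1 axy) cyw.
rewrite !inE cxw /=; apply: (@leq_ltn_trans (size p1)).
  by rewrite leq_dist // -lp1 within_path.
rewrite ltnNge; apply: contra nxz; rewrite leq_dist // => wxw.
by apply: within_leq sp _; apply: within_trans wxw _; rewrite -lp2 within_path.
Qed.

Lemma arc_to_both (G : sgraph) s t (x y : G) :
  arc_to setT s x y -> arc_to setT t y x -> s.+1 + t.+1 <= #|component x|.
Proof.
move=> axy ayx; have adj_xy : adj x y by case/andP: axy.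
have eq_comp : component y = component x.
  apply/setP => w; rewrite !inE; apply/esym/same_connect; last exact: connect1.
  exact: connect_adj_sym.
apply: leq_trans (leq_add (arc_to_side axy) (arc_to_side ayx)) _.
rewrite eq_comp -cardsUI.
have -> : [set w in component x | dist y w < dist x w] :&:
          [set w in component x | dist x w < dist y w] = set0.
  by apply/setP => w; rewrite !inE; case: ltngtP; rewrite ?andbF.
rewrite cards0 addn0; apply/subset_leq_card/subsetP => w.
by rewrite !inE => /orP[]/andP[].
Qed.

(* Moving from every vertex towards a far one must eventually turn back, since
   the component is too small to contain a cycle. *)
Lemma opposite_arcs (G : sgraph) t (z : G) :
  (forall x : G, 0 < legs setT t x) ->
  (forall c, ucycle (@adj G) c -> 2 < size c -> #|component z| < size c) ->
  exists x y, [/\ connect (@adj G) z x, arc_to setT t x y & arc_to setT t y x].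
Proof.
move=> legs_gt0 long_cycles.
pose f (x : G) := odflt x [pick y | arc_to setT t x y].
have fP x : arc_to setT t x (f x).
  rewrite /f; case: pickP => [//|none]; have := legs_gt0 x.
  by case/card_gt0P=> y; rewrite !inE none.
have f_adj x : adj x (f x) by case/andP: (fP x).
have con_iter i x : connect (@adj G) x (iter i f x).
  by elim: i => [|i IHi] /=; [exact: connect0 | apply: connect_trans IHi (connect1 (f_adj _))].
(* By pigeonhole the orbit of [z] under [f] becomes periodic. The least period in the component is
   [p.+1]. *)
have exP : exists p, [exists x in component z, iter p.+1 f x == x].
  have [inj|] := boolP (injectiveb (fun i : 'I_#|G|.+1 => iter i f z)).
    by have := leq_card _ (injectiveP _ inj); rewrite card_ord ltnn.
  case/injectivePn=> i [j neq_ij eq_ij].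
  wlog lt_ij : i j neq_ij eq_ij / i < j.
    move=> wl; have [|lt_ji|/val_inj e] := ltngtP i j; last by rewrite e eqxx in neq_ij.
      exact: wl.
    by apply: (wl j i) => //; rewrite eq_sym.
  exists (j - i.+1); apply/exists_inP; exists (iter i f z); first by rewrite inE.
  by rewrite -iterD addSnnS subnK // eq_ij.
case: (ex_minnP exP) => p /exists_inP[x xZ /eqP fpx] min_p.
rewrite inE in xZ.
have ut : uniq (traject f x p.+1).
  apply/(uniqP x) => i j; rewrite !inE size_traject => lti ltj.
  rewrite !nth_traject // => eq_ij; apply/eqP/negPn/negP => neq_ij.
  wlog lt_ij : i j lti ltj eq_ij neq_ij / i < j.
    move=> wl; move: (neq_ij); rewrite neq_ltn => /orP[lt_ij|lt_ji].
      exact: (wl i j).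
    by apply: (wl j i ltj lti (esym eq_ij)); rewrite // eq_sym.
  suff /min_p : [exists w in component z, iter (j - i.+1).+1 f w == w].
    by move: ltj lt_ij; lia.
  apply/exists_inP; exists (iter i f x).
    by rewrite inE; apply: connect_trans xZ (con_iter i x).
  by rewrite -iterD addSnnS subnK // eq_ij.
have cyc : ucycle (@adj G) (traject f x p.+1).
  rewrite /ucycle ut andbT /=.
  have -> : rcons (traject f (f x) p) x = traject f (f x) p.+1.
    by rewrite trajectSr -iterSr fpx.
  by apply: sub_path (fpath_traject f x p.+1) => a b /eqP <-.
(* An orbit of more than two vertices is a cycle inside the component, excluded by [long_cycles]; a
   fixed point would be adjacent to itself; an orbit of two vertices gives the opposite arcs. *)
have [lt2|] := ltnP 2 p.+1.
  have := long_cycles _ cyc; rewrite size_traject lt2 => /(_ isT).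
  rewrite ltnNge -{1}(size_traject f x p.+1) -(card_uniqP ut).
  rewrite subset_leq_card //; apply/subsetP => w /trajectP[i _ ->].
  by rewrite inE; apply: connect_trans xZ (con_iter i x).
case: p fpx {min_p ut cyc exP} => [|[|//]] /= fpx _.
  by have := f_adj x; rewrite fpx adj_irrefl.
by exists x, (f x); split=> //; have := fP (f x); rewrite fpx.
Qed.

Lemma component_even (G : sgraph) t (z : G) :
  (forall x : G, 0 < legs setT t x) ->
  (forall c, ucycle (@adj G) c -> 2 < size c -> #|component z| < size c) ->
  2 * t.+1 <= #|component z|.
Proof.
move=> legs_gt0 long_cycles.
have [x [y [zx axy ayx]]] := opposite_arcs legs_gt0 long_cycles.
have := arc_to_both axy ayx; rewrite (_ : component x = component z); first lia.
by apply/setP => w; rewrite !inE (same_connect (@connect_adj_sym G) zx).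
Qed.

(** Of two opposite arcs of depth [t], one also has depth [t.+1], which adds one vertex to the bound
    of [component_even]. *)
Lemma component_odd (G : sgraph) t (z : G) :
  (forall x : G, 0 < legs setT t x) ->
  (forall x y : G, adj x y -> arc_to setT t.+1 x y || arc_to setT t.+1 y x) ->
  (forall c, ucycle (@adj G) c -> 2 < size c -> #|component z| < size c) ->
  2 * t.+1 + 1 <= #|component z|.
Proof.
move=> legs_gt0 far long_cycles.
have [x [y [zx axy ayx]]] := opposite_arcs legs_gt0 long_cycles.
have -> : component z = component x.
  by apply/setP => w; rewrite !inE (same_connect (@connect_adj_sym G) zx).
have := far x y; case/andP: (axy) => -> _ /(_ isT) /orP[axy'|ayx'].
  by have := arc_to_both axy' ayx; lia.
by have := arc_to_both axy ayx'; lia.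
Qed.

(** The first [t.+1] steps of a shortest path to a vertex outside the ball form a leg. *)
Lemma connected_legs (G : sgraph) t (x : G) :
  connected G -> #|ball t.+1 [:: x]| < #|G| -> 0 < legs setT t x.
Proof.
move=> [_ conG] ltB; have [w wB] : exists w, w \notin ball t.+1 [:: x].
  by apply/existsP; apply: contraLR ltB; rewrite negb_exists -leqNgt => /forallP allB;
     rewrite -cardsT subset_leq_card //; apply/subsetP => w _; have := allB w; rewrite negbK.
rewrite in_ball1 -leq_dist // -ltnNge in wB.
have /withinP[p [pp lp sp _]] : within setT (dist x w) x w by rewrite -leq_dist.
have size_p : dist x w <= size p by rewrite leq_dist // -lp within_path.
case: p pp lp sp size_p => [|y p] /= pp lp sp size_p; first by lia.
case/andP: pp => axy pp; apply/card_gt0P; exists y; rewrite inE in_setT /arc_to axy /=.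
have def_p := cat_take_drop t p.
have st : size (take t p) = t by rewrite size_takel //; lia.
rewrite -def_p cat_path in pp; case/andP: pp => pp1 pp2.
apply/exists_inP; exists (last y (take t p)) => //; apply/andP; split.
  by have := within_path pp1; rewrite st.
apply/negP => wx; have : within setT (t + size (drop t p)) x w.
  have <- : last (last y (take t p)) (drop t p) = w by rewrite -last_cat def_p.
  exact: within_trans wx (within_path pp2).
by rewrite -leq_dist // size_drop; lia.
Qed.

(** A vertex outside the ball is closer to one end of the edge, and the arc towards that end has
    depth [t]. *)
Lemma tree_far_edge (T : sgraph) t (x y : T) : is_tree T -> adj x y ->
  #|ball t [:: x; y]| < #|T| -> arc_to setT t x y || arc_to setT t y x.
Proof.
move=> [[n0 conT] acT].
suff half (a b w : T) : adj a b -> dist a w = (dist b w).+1 -> t < dist b w -> arc_to setT t a b.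
  move=> axy ltB; have [w wB] : exists w, w \notin ball t [:: x; y].
    by apply/existsP; apply: contraLR ltB; rewrite negb_exists -leqNgt => /forallP allB;
     rewrite -cardsT subset_leq_card //; apply/subsetP => w _; have := allB w; rewrite negbK.
  rewrite in_ball2 negb_or -!leq_dist // -!ltnNge in wB; case/andP: wB => tx ty.
  have [e|e] := dist_adj_cases acT axy (conT x w).
    by rewrite (half x y w).
  by rewrite (half y x w) ?orbT // adj_sym.
move=> aab e lt_t; rewrite /arc_to aab /=.
have /withinP[p [pp lp sp _]] : within setT (dist b w) b w by rewrite -leq_dist.
have size_p : dist b w <= size p by rewrite leq_dist // -lp within_path.
have def_p := cat_take_drop t p.
have st : size (take t p) = t by rewrite size_takel //; lia.
rewrite -def_p cat_path in pp; case/andP: pp => pp1 pp2.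
apply/exists_inP; exists (last b (take t p)) => //; apply/andP; split.
  by have := within_path pp1; rewrite st.
apply/negP => wx; have : within setT (t + size (drop t p)) a w.
  have <- : last (last b (take t p)) (drop t p) = w by rewrite -last_cat def_p.
  exact: within_trans wx (within_path pp2).
by rewrite -leq_dist // size_drop; lia.
Qed.

(** * Balls around a shortest cycle *)

(** Indices are read modulo the length, so a step back is written as adding [(size c).-1]. *)
Definition cyc (G : sgraph) (x0 : G) (c : seq G) (i : nat) : G := nth x0 c (i %% size c).

Record shortest (G : sgraph) (c : seq G) : Prop := Shortest {
  shortest_ucycle : ucycle (@adj G) c;
  shortest_size : 2 < size c;
  shortest_min : forall c', ucycle (@adj G) c' -> 2 < size c' -> size c <= size c' }.

Lemma cyc_adj (G : sgraph) (x0 : G) c i : shortest c -> adj (cyc x0 c i) (cyc x0 c i.+1).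
Proof.
case=> /andP[cc _] lt2 _; rewrite /cyc -addn1 -modnDml addn1.
have : i %% size c < size c by rewrite ltn_mod; lia.
case: c cc lt2 => // x s /(pathP x0) cc _; move: (i %% _) => {}i lti.
have := cc i; rewrite size_rcons => /(_ lti).
rewrite -rcons_cons nth_rcons lti nth_rcons /=.
have [lt_is|] := boolP (i < size s); first by rewrite modn_small.
rewrite -leqNgt => le_si; have -> : i = size s by apply/eqP; rewrite eqn_leq le_si -ltnS lti.
by rewrite eqxx modnn.
Qed.

Lemma cyc_mem (G : sgraph) (x0 : G) c i : shortest c -> cyc x0 c i \in c.
Proof. by case=> _ lt2 _; rewrite mem_nth // ltn_mod; lia. Qed.

Lemma cycP (G : sgraph) (x0 x : G) c : x \in c -> exists i, x = cyc x0 c i.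
Proof. by move=> xc; exists (index x c); rewrite /cyc modn_small ?nth_index // index_mem. Qed.

Lemma cyc_inj (G : sgraph) (x0 : G) c i j :
  shortest c -> cyc x0 c i = cyc x0 c j -> i = j %[mod size c].
Proof.
case=> /andP[_ uc] lt2 _ /eqP; rewrite nth_uniq ?ltn_mod //; try lia.
Qed.

Lemma cyc_addn (G : sgraph) (x0 : G) c i : cyc x0 c (i + size c) = cyc x0 c i.
Proof. by rewrite /cyc modnDr. Qed.

Lemma cyc_addnM (G : sgraph) (x0 : G) c i m : cyc x0 c (i + m * size c) = cyc x0 c i.
Proof. by rewrite /cyc addnC modnMDl. Qed.

Lemma cyc_adj_back (G : sgraph) (x0 : G) c i :
  shortest c -> adj (cyc x0 c i) (cyc x0 c (i + (size c).-1)).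
Proof.
move=> sc; rewrite adj_sym -(cyc_addn x0 c i).
have -> : i + size c = (i + (size c).-1).+1 by case: sc; lia.
exact: cyc_adj.
Qed.

(* Walking with step [u] in [{1, size c - 1}] along the cycle. *)
Lemma cyc_path (G : sgraph) (x0 : G) c i u q : shortest c ->
  (forall j, adj (cyc x0 c j) (cyc x0 c (j + u))) -> coprime (size c) u ->
  q < size c ->
  let p := [seq cyc x0 c (i + j * u) | j <- iota 1 q] in
  [/\ path (@adj G) (cyc x0 c i) p, last (cyc x0 c i) p = cyc x0 c (i + q * u),
      uniq (cyc x0 c i :: p), size p = q & {subset p <= c}].
Proof.
move=> sc adju cop lt_q p.
have pathp m n : path (@adj G) (cyc x0 c (i + m * u))
    [seq cyc x0 c (i + j * u) | j <- iota m.+1 n].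
  by elim: n m => //= n IHn m; rewrite IHn mulSn (addnC u) addnA adju.
have lastp m n : last (cyc x0 c (i + m * u)) [seq cyc x0 c (i + j * u) | j <- iota m.+1 n] =
    cyc x0 c (i + (m + n) * u).
  by elim: n m => [m|n IHn m] /=; rewrite ?addn0 // IHn addSnnS.
split.
- by have := pathp 0 q; rewrite mul0n addn0.
- by have := lastp 0 q; rewrite mul0n addn0 add0n.
- have -> : cyc x0 c i :: p = [seq cyc x0 c (i + j * u) | j <- iota 0 q.+1].
    by rewrite /= mul0n addn0.
  rewrite map_inj_in_uniq ?iota_uniq // => j m; rewrite !mem_iota /= => ltj ltm.
  move/(cyc_inj sc)/eqP; rewrite eqn_modDl => /eqP.
  wlog le_jm : j m ltj ltm / j <= m => [wl|/esym/eqP].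
    by case: (leqP j m) => [/wl|/ltnW/wl wl' /esym/wl'->]; rewrite //; apply.
  rewrite eqn_mod_dvd ?leq_mul2r ?le_jm ?orbT // -mulnBl Gauss_dvdl // => dv.
  have [|/dvdn_leq-/(_ _ dv)] := posnP (m - j); first by move: le_jm; lia.
  by move: ltm lt_q; lia.
- by rewrite size_map size_iota.
by move=> x /mapP[j _ ->]; apply: cyc_mem.
Qed.

Lemma two_paths_shortest (G : sgraph) (c : seq G) a p q : shortest c ->
  path (@adj G) a p -> path (@adj G) a q -> uniq (a :: p) -> uniq (a :: q) ->
  last a p = last a q -> p <> q -> size c <= size p + size q.
Proof.
move=> [_ _ min_c] pp pq up uq eql neq.
have [c' [cc' lt2' le_c']] := two_paths_cycle pp pq up uq eql neq.
exact: leq_trans (min_c c' cc' lt2') le_c'.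
Qed.

(* A path leaving the cycle and coming back closes up with either of the two
   arcs, so twice its length is at least the length of the cycle. *)
Lemma excursion_length (G : sgraph) (x0 : G) c i q m : shortest c ->
  0 < q < size c -> path (@adj G) (cyc x0 c i) (rcons m (cyc x0 c (i + q))) ->
  uniq (cyc x0 c i :: rcons m (cyc x0 c (i + q))) ->
  {in m, forall x, x \notin c} -> (m = [::] -> 1 < q < (size c).-1) ->
  size c <= 2 * (size m).+1.
Proof.
move=> sc /andP[q_gt0 lt_q] pm um offm m0.
have [_ lt2 _] := sc.
have [] := @cyc_path G x0 c i 1 q sc _ _ lt_q.
- by move=> j; rewrite addn1; apply: cyc_adj.
- by rewrite coprimen1.
rewrite muln1 => p1 l1 u1 s1 sub1.
(* The complementary arc: [size c - q] steps backwards also end at index [i + q]. *)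
have [] := @cyc_path G x0 c i (size c).-1 (size c - q) sc _ _ _.
- by move=> j; apply: cyc_adj_back.
- by rewrite coprimenP //; lia.
- by lia.
have -> : cyc x0 c (i + (size c - q) * (size c).-1) = cyc x0 c (i + q).
  rewrite -(cyc_addnM x0 c (i + q) (size c - q.+1)) -addnA; congr (cyc _ _ (i + _)).
  have [e def_c] : exists e, size c = q + e.+1 by exists (size c - q.+1); lia.
  by rewrite def_c; nia.
move=> p2 l2 u2 s2 sub2.
set p := [seq _ | j <- iota 1 q] in p1 l1 u1 s1 sub1.
set p' := [seq _ | j <- iota 1 (size c - q)] in p2 l2 u2 s2 sub2.
(* The path differs from both arcs: it has a vertex off the cycle, or it is a single edge, and then
   both arcs are longer. *)
have neq_arc r : {subset r <= c} -> size r = q \/ size r = size c - q ->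
    rcons m (cyc x0 c (i + q)) <> r.
  move=> subr sr def_r; case: m m0 offm def_r {pm um} => [|x m] m0 offm def_r.
    by move: sr (m0 erefl); rewrite -def_r /=; lia.
  by have := offm x (mem_head _ _); rewrite subr // -def_r mem_head.
(* The arcs have lengths [q] and [size c - q], so [q] cancels when the two bounds are added. *)
have := two_paths_shortest sc pm p1 um u1.
have := two_paths_shortest sc pm p2 um u2.
rewrite !last_rcons l1 l2 s1 s2 size_rcons => /(_ erefl).
move=> /(_ (neq_arc _ sub2 (or_intror s2))) h2.
move=> /(_ erefl (neq_arc _ sub1 (or_introl s1))) h1.
by lia.
Qed.

(** The cycle has no detours of length up to [d]: the path with inner vertices [m] has [(size m).+1]
    edges. The estimates for balls near the cycle rest on this. *)
Record no_excursion (G : sgraph) (c : seq G) (d : nat) : Prop := NoExcursion {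
  noexc_shortest : shortest c;
  noexc_size : d.+1 < size c;
  noexc_pos : 0 < d;
  noexc_path : forall x0 i i' m,
    path (@adj G) (cyc x0 c i) (rcons m (cyc x0 c i')) ->
    uniq (cyc x0 c i :: rcons m (cyc x0 c i')) -> {in m, forall x, x \notin c} ->
    size m < d -> m = [::] /\
    (cyc x0 c i' = cyc x0 c i.+1 \/ cyc x0 c i' = cyc x0 c (i + (size c).-1)) }.

(** The cycle, [m] and [component z] are disjoint. Together with [size m < d <= #|component z| + 1]
    this gives [2 * size m <= #|G| - size c <= size c - 3], against [excursion_length]. *)
Lemma few_vertices_no_excursion (G : sgraph) (c : seq G) (z : G) d :
  shortest c -> d.+1 < size c -> 0 < d -> d <= (#|component z|).+1 ->
  (forall x, x \in c -> ~~ connect (@adj G) z x) ->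
  #|G| + 3 <= 2 * size c -> no_excursion c d.
Proof.
move=> sc lt_d d_gt0 le_dZ cZ le_n; split=> // x0 i i' m pm um offm lt_m.
have [q [lt_q def_i']] : exists q, q < size c /\ cyc x0 c i' = cyc x0 c (i + q).
  (* This is [i' - i] modulo the length. *)
  exists ((i' + i * (size c).-1) %% size c); split; first by rewrite ltn_mod; lia.
  rewrite /cyc modnDmr; congr (nth _ _ _).
  have -> : i + (i' + i * (size c).-1) = i * size c + i'.
    have [e ->] : exists e, size c = e.+1 by exists (size c).-1; lia.
    by rewrite /=; nia.
  by rewrite modnMDl.
rewrite {}def_i' in pm um *.
have q_gt0 : 0 < q.
  rewrite lt0n; apply: contraL um => /eqP->; rewrite addn0 /= mem_rcons mem_head.
  by [].
have small : 2 * (size m).+1 < size c.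
  have con_m x : x \in m -> connect (@adj G) (cyc x0 c i) x.
    move=> xm; case/splitPr: m / xm pm {um offm lt_m} => m1 m2.
    rewrite rcons_cat -cat_rcons cat_path => /andP[pm1 _].
    by apply/connectP; exists (rcons m1 x); rewrite ?last_rcons.
  have disj_m : [disjoint [set x in m] & component z].
    rewrite -setI_eq0; apply/eqP/setP => x; rewrite !inE; apply/negP => /andP[xm zx].
    have := cZ _ (cyc_mem x0 i sc); rewrite (connect_trans zx) //.
    by rewrite connect_adj_sym; apply: con_m.
  have disj_c : [disjoint [set x in c] & [set x in m] :|: component z].
    rewrite -setI_eq0; apply/eqP/setP => x; rewrite !inE; apply/negP.
    by case/andP=> xc /orP[/offm|]; rewrite ?xc //; apply/negP/cZ.
  have um' : uniq m by move: um; rewrite /= rcons_uniq => /and3P[].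
  have uc : uniq c by case: sc => /andP[].
  have := max_card ([set x in c] :|: ([set x in m] :|: component z)).
  have card_c : #|[set x in c]| = size c by rewrite cardsE (card_uniqP uc).
  have card_m : #|[set x in m]| = size m by rewrite cardsE (card_uniqP um').
  rewrite cardsU (disjoint_setI0 disj_c) cardsU (disjoint_setI0 disj_m).
  by rewrite !cards0 !subn0 card_c card_m; lia.
have exc := excursion_length sc _ pm um offm.
have lt0q : 0 < q < size c by rewrite q_gt0.
case: m => [|x m] in pm um offm lt_m small exc *; last first.
  have : size c <= 2 * (size (x :: m)).+1 by apply: exc.
  by lia.
split=> //; have [->|neq1] := eqVneq q 1; first by left; rewrite addn1.
have [->|neq2] := eqVneq q (size c).-1; first by right.
have : size c <= 2 * 1 by apply: exc => // _; lia.
by case: sc; lia.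
Qed.

(** If the ends differed, shortening the walk after its first step would give a simple path with
    non-empty interior off the cycle, which [no_excursion] forbids. *)
Lemma off_cycle_walk (G : sgraph) (x0 : G) c d i i' m : no_excursion c d ->
  path (@adj G) (cyc x0 c i) (rcons m (cyc x0 c i')) -> m <> [::] ->
  {in m, forall x, x \notin c} -> size m < d -> cyc x0 c i = cyc x0 c i'.
Proof.
move=> ne pm m0 offm lt_m; have sc := noexc_shortest ne.
apply/eqP/negPn/negP => neq.
case: m => [//|y m] in pm m0 offm lt_m *; move: pm => /= /andP[ay pm].
set a := cyc x0 c i in neq ay *; set a1 := cyc x0 c i' in neq pm *.
have [ac a1c] : a \in c /\ a1 \in c by split; apply: cyc_mem.
have yc : y \notin c by apply: offm; apply: mem_head.
have [q [pq uq offq sq]] : exists q, [/\ path (@adj G) y (rcons q a1),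
    uniq (y :: rcons q a1), {in y :: q, forall x, x \notin c} & size q <= size m].
  have := last_rcons y m a1; case: (shortenP pm) => p pp up subp lastp.
  case/lastP: p lastp pp up subp => [/= e|q b]; first by rewrite e a1c in yc.
  rewrite last_rcons => -> pq uq subq; exists q; split=> //.
    move=> x; rewrite inE => /predU1P[->//|xq].
    have : x \in rcons m a1 by apply: subq; rewrite mem_rcons inE xq orbT.
    rewrite mem_rcons inE => /predU1P[ex|xm]; last by apply: offm; rewrite inE xm orbT.
    by move: uq; rewrite /= rcons_uniq -ex xq andbF.
  rewrite -ltnS -(size_rcons q a1) -(size_rcons m a1); apply: uniq_leq_size => //.
  by case/andP: uq.
have [] := noexc_path ne (x0 := x0) (i := i) (i' := i') (m := y :: q).
- by rewrite /= ay.
- rewrite cons_uniq [X in _ && X]uq andbT inE negb_or mem_rcons inE negb_or neq.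
  have aN x : x \in y :: q -> a != x by move=> /offq; apply: contraNneq => <-.
  rewrite aN ?mem_head //=; apply/negP => aq.
  by have := aN a; rewrite inE aq orbT eqxx => /(_ isT).
- exact: offq.
- by apply: leq_ltn_trans lt_m.
by [].
Qed.

Lemma first_hit (G : sgraph) (x0 : G) c s x z : shortest c -> x \notin c -> z \in c ->
  within setT s x z -> exists m i, [/\ path (@adj G) x (rcons m (cyc x0 c i)),
    {in m, forall w, w \notin c}, size m < s &
    within setT (s - (size m).+1) (cyc x0 c i) z].
Proof.
move=> sc xc zc /withinP[p [pp lp sp _]].
have hasp : has (mem c) p.
  apply/hasP; exists z => //; rewrite -lp; case: p lp {pp sp} => [e|y p _].
    by rewrite -e /= in zc; rewrite zc in xc.
  by rewrite /= mem_last.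
move: pp lp sp; have [w m q /= wc /hasPn offm] := split_find hasp.
rewrite cat_path last_cat last_rcons size_cat size_rcons => /andP[pm pq] lq sp.
have [i def_w] := cycP x0 wc; exists m, i; rewrite -def_w.
have lt_m : size m < s by apply: leq_trans sp; apply: leq_addr.
split; [exact: pm | exact: offm | exact: lt_m |].
apply: (@within_leq _ _ (size q)); first by rewrite leq_subRL.
by rewrite -lq within_path.
Qed.

(** The index of [z] is [i + j - s], with [- s] written as [s * (size c).-1]. A step along the cycle
    shifts the index by one either way, and a walk off the cycle returns to the vertex where it
    left. *)
Lemma within_cycle (G : sgraph) (x0 : G) c d s i z : no_excursion c d -> s <= d ->
  z \in c -> within setT s (cyc x0 c i) z ->
  exists2 j, j <= 2 * s & z = cyc x0 c (i + j + s * (size c).-1).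
Proof.
move=> ne le_sd zc; have sc := noexc_shortest ne; have [_ lt2 _] := sc.
have [n le_n] := ubnP s; elim: n s i le_n le_sd => // n IHn [|s] i le_n le_sd wz.
  by exists 0 => //; rewrite mul0n !addn0; apply/esym/eqP.
(* A shorter walk from the same vertex is enough: [j] is shifted by the difference of the
   lengths. *)
have weaken s' i' : s' <= s -> cyc x0 c i' = cyc x0 c i ->
    within setT s' (cyc x0 c i') z ->
    exists2 j, j <= 2 * s.+1 & z = cyc x0 c (i + j + s.+1 * (size c).-1).
  move=> le_s' ei' wz'; rewrite ei' in wz'.
  have [||j le_j ->] := IHn s' i _ _ wz'; [by lia | by lia |].
  exists (j + (s.+1 - s')); first by lia.
  rewrite -(cyc_addnM x0 c _ (s.+1 - s')); congr (cyc _ _ _).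
  have [e ->] : exists e, s = s' + e by exists (s - s'); lia.
  rewrite -addnS addKn; have [f ->] : exists f, size c = f.+1 by exists (size c).-1; lia.
  by rewrite /=; nia.
case/withinP: wz => -[|y p] [/= pp lp sp _].
  by apply: (weaken 0 i) => //; rewrite lp within0.
case/andP: pp => ay pp.
have wyz : within setT s y z.
  by apply: within_leq (_ : size p <= s) _ => //; rewrite -lp within_path.
have [yc|yc] := boolP (y \in c).
  have [i' def_y] := cycP x0 yc; rewrite def_y in ay wyz.
  have [||||_ [e|e]] := noexc_path ne (x0 := x0) (i := i) (i' := i') (m := [::]).
  - by rewrite /= ay.
  - by rewrite /= inE !andbT; apply: contraTneq ay => ->; rewrite adj_irrefl.
  - by [].
  - exact: noexc_pos ne.
  - rewrite e in wyz; have [||j le_j ->] := IHn s i.+1 _ _ wyz; [by lia | by lia |].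
    exists (j + 2); first by lia.
    by rewrite -[LHS]cyc_addn; congr (cyc _ _ _); rewrite mulSn; lia.
  rewrite e in wyz.
  have [||j le_j ->] := IHn s (i + (size c).-1) _ _ wyz; [by lia | by lia |].
  exists j; first by lia.
  by congr (cyc _ _ _); rewrite mulSn; lia.
have [m [i' [pm offm sm wz']]] := first_hit x0 sc yc zc wyz.
apply: (weaken (s - (size m).+1) i') => //; first by lia.
apply/esym; apply: (off_cycle_walk ne (m := y :: m)) => //=; first by rewrite ay.
  by move=> x; rewrite inE => /predU1P[->|/offm].
by lia.
Qed.

Lemma cyc_within (G : sgraph) (x0 : G) c i t :
  shortest c -> within setT t (cyc x0 c i) (cyc x0 c (i + t)).
Proof.
move=> sc; elim: t i => [|t IHt] i; first by rewrite addn0 within0.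
apply: within_cons (in_setT (cyc x0 c i.+1)) (cyc_adj x0 i sc) _.
by rewrite addnS -addSn.
Qed.

Lemma cyc_within_back (G : sgraph) (x0 : G) c i t :
  shortest c -> within setT t (cyc x0 c i) (cyc x0 c (i + t * (size c).-1)).
Proof.
move=> sc; elim: t i => [|t IHt] i; first by rewrite addn0 within0.
apply: within_cons (in_setT (cyc x0 c (i + (size c).-1))) (cyc_adj_back x0 i sc) _.
by rewrite mulSn addnA.
Qed.

(** The witness has index [i + t + 1]. It is not among the indices from [i - t] to [i + t] because
    [2 * t + 1 < size c]. *)
Lemma cyc_arc (G : sgraph) (x0 : G) c d i t : no_excursion c d -> t <= d ->
  2 * t + 1 < size c -> arc_to setT t (cyc x0 c i) (cyc x0 c i.+1).
Proof.
move=> ne le_td lt_t; have sc := noexc_shortest ne; rewrite /arc_to cyc_adj //=.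
apply/exists_inP; exists (cyc x0 c (i.+1 + t)); rewrite ?inE // cyc_within //=.
apply/negP => /(within_cycle ne le_td (cyc_mem _ _ sc))[j le_j].
move/(cyc_inj sc)/eqP; rewrite addSn -addnS -addnA eqn_modDl.
rewrite -(eqn_modDr t) -addnA (_ : t * _ + t = t * size c); last first.
  by rewrite -{2}(muln1 t) -mulnDr; congr (_ * _); lia.
rewrite addnC addnS addnC modnMDl.
rewrite !modn_small; lia.
Qed.

Lemma cyc_arc_back (G : sgraph) (x0 : G) c d i t : no_excursion c d -> t <= d ->
  2 * t + 1 < size c -> arc_to setT t (cyc x0 c i.+1) (cyc x0 c i).
Proof.
move=> ne le_td lt_t; have sc := noexc_shortest ne.
rewrite /arc_to adj_sym cyc_adj //=.
apply/exists_inP; exists (cyc x0 c (i + t * (size c).-1)); rewrite ?inE //.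
rewrite cyc_within_back //=.
apply/negP => /(within_cycle ne le_td (cyc_mem _ _ sc))[j le_j].
move/(cyc_inj sc)/eqP; rewrite eqn_modDr addSn -addnS -{1}(addn0 i) eqn_modDl.
rewrite !modn_small; lia.
Qed.

Lemma card_image_leq (I : finType) (f : nat -> I) (D : {set I}) n :
  (forall z, z \in D -> exists2 j, j < n & z = f j) -> #|D| <= n.
Proof.
move=> fD; have : #|[set f j | j : 'I_n]| <= n.
  by apply: leq_trans (leq_imset_card _ _) _; rewrite card_ord.
apply: leq_trans; apply/subset_leq_card/subsetP => z /fD[j lt_j ->].
by apply/imsetP; exists (Ordinal lt_j).
Qed.

Lemma card_near_cycle (G : sgraph) (c : seq G) d s x : no_excursion c d -> s <= d ->
  x \in c -> #|[set z in ball s [:: x] | z \in c]| <= 2 * s + 1.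
Proof.
move=> ne le_sd xc; have [i def_x] := cycP x xc.
apply: (card_image_leq (f := fun j => cyc x c (i + j + s * (size c).-1))) => z.
rewrite inE in_ball1 => /andP[]; rewrite {1}def_x => wz zc.
have [j le_j ->] := within_cycle ne le_sd zc wz; exists j => //; lia.
Qed.

(* Short paths from [x] and [y] to the cycle all enter it at the same vertex. *)
Lemma gate (G : sgraph) (c : seq G) d s x y : no_excursion c d ->
  x \notin c -> y \notin c -> (x == y) || adj x y -> 2 * s + (x != y) <= d ->
  exists2 a, a \in c & forall z, z \in c ->
    within setT s x z || within setT s y z -> within setT s.-1 a z.
Proof.
move=> ne xc yc axy le_d; have sc := noexc_shortest ne.
pose near z := within setT s x z || within setT s y z.
have [/exists_inP[z0 z0c nz0]|/exists_inPn none] := boolP [exists z in [set z in c], near z];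
  last first.
  (* If no cycle vertex is near, any vertex of the cycle serves as the gate. *)
  have /card_gt0P[a ac] : 0 < #|[set z in c]|.
    rewrite cardsE (card_uniqP _); first by case: sc; lia.
    by case: sc => /andP[].
  rewrite inE in ac; exists a => // z zc nz.
  by have := none z; rewrite inE zc => /(_ isT)/negP.
rewrite inE in z0c.
have [u [m [i [ux pm offm [lt_m _]]]]] : exists u m i, [/\ u = x \/ u = y,
    path (@adj G) u (rcons m (cyc x c i)), {in m, forall w, w \notin c} &
    size m < s /\ u \notin c].
  by case/orP: nz0 => w0; [have [m [i [? ? ? _]]] := first_hit x sc xc z0c w0; exists x
    | have [m [i [? ? ? _]]] := first_hit x sc yc z0c w0; exists y];
    exists m, i; split=> //; by [left | right].
exists (cyc x c i); first exact: cyc_mem.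
move=> z zc nz.
have [v [m' [i' [vx pm' offm' [lt_m' vc] wz]]]] : exists v m' i', [/\ v = x \/ v = y,
    path (@adj G) v (rcons m' (cyc x c i')), {in m', forall w, w \notin c},
    size m' < s /\ v \notin c & within setT (s - (size m').+1) (cyc x c i') z].
  by case/orP: nz => w0; [have [m' [i' [? ? ? ?]]] := first_hit x sc xc zc w0; exists x
    | have [m' [i' [? ? ? ?]]] := first_hit x sc yc zc w0; exists y];
    exists m', i'; split=> //; by [left | right].
have uc : u \notin c by case: ux => ->.
(* From one entry point back to [u], over to [v] and out to the other entry point is a walk off the
   cycle with fewer than [d] inner vertices, so both entry points agree. *)
suff -> : cyc x c i = cyc x c i' by apply: within_leq wz; clear; lia.
have pback : path (@adj G) (cyc x c i) (rcons (rev m) u) by rewrite path_rcons_rev.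
have [euv|neq_uv] := eqVneq u v.
  apply: (off_cycle_walk (x0 := x) ne (m := rcons (rev m) u ++ m')).
  - by rewrite rcons_cat cat_path last_rcons pback /= euv.
  - by case: (rev m).
  - move=> w; rewrite mem_cat mem_rcons inE mem_rev -orbA => /or3P[/eqP->|/offm|/offm'] //.
  - rewrite size_cat size_rcons size_rev -addnS.
    by apply: leq_trans (leq_add lt_m lt_m') _; move: le_d; clear; lia.
have auv : adj u v.
  case: ux vx neq_uv axy => -> [] ->; rewrite ?eqxx // => neq.
    by rewrite (negPf neq).
  by rewrite eq_sym (negPf neq) adj_sym.
have neq_xy : x != y.
  by case: ux vx neq_uv => -> [] ->; rewrite ?eqxx // eq_sym.
apply: (off_cycle_walk (x0 := x) ne (m := rcons (rev m) u ++ v :: m')).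
- by rewrite rcons_cat cat_path last_rcons pback /= auv.
- by case: (rev m).
- move=> w; rewrite mem_cat mem_rcons !inE mem_rev -orbA.
  by case/or4P=> [/eqP->|/offm|/eqP->|/offm'].
- rewrite size_cat size_rcons size_rev /= -addnS addnS.
  apply: leq_ltn_trans (leq_add lt_m lt_m') _; move: le_d; rewrite neq_xy; clear; lia.
Qed.

(** Reaching the gate takes at least one step, so on the cycle the ball is covered by the ball of
    radius [s.-1] around the gate. *)
Lemma card_ball_off_cycle (G : sgraph) (c : seq G) d s x : no_excursion c d ->
  2 * s <= d -> x \notin c -> #|[set z in ball s [:: x] | z \in c]| <= 2 * s.-1 + 1.
Proof.
move=> ne le_d xc.
have [||a ac ga] := gate (s := s) (y := x) ne xc xc; [by rewrite eqxx | by rewrite eqxx addn0 |].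
apply: leq_trans (card_near_cycle (s := s.-1) ne _ ac); last by lia.
apply/subset_leq_card/subsetP => z /setIdP[]; rewrite in_ball1 => wz zc.
by apply/setIdP; rewrite in_ball1 ga // wz.
Qed.

Lemma card_ball_vertex (G : sgraph) (c : seq G) d s x : no_excursion c d ->
  2 * s <= d -> #|[set z in ball s [:: x] | z \in c]| <= 2 * s + 1.
Proof.
move=> ne le_d; have [xc|xc] := boolP (x \in c).
  by apply: card_near_cycle ne _ xc; lia.
by apply: leq_trans (card_ball_off_cycle ne le_d xc) _; lia.
Qed.

(** An edge on the cycle covers one more vertex than a ball around one end. If one end is on the
    cycle, the other adds nothing there; if both are off it, they share a gate. *)
Lemma card_ball_edge (G : sgraph) (c : seq G) d s x y : no_excursion c d ->
  2 * s + 1 <= d -> adj x y ->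
  #|[set z in ball s [:: x; y] | z \in c]| <= 2 * s + 2.
Proof.
move=> ne le_d axy; have sc := noexc_shortest ne.
have neq_xy : x != y by apply: contraTneq axy => ->; rewrite adj_irrefl.
have half u v : adj u v -> u \in c -> v \notin c ->
    #|[set z in ball s [:: u; v] | z \in c]| <= 2 * s + 2.
  move=> auv uc vc; have le_sd : s <= d by lia.
  apply: leq_trans (leq_trans (card_near_cycle (s := s) ne le_sd uc) _); last by lia.
  apply/subset_leq_card/subsetP => z /setIdP[]; rewrite in_ball2 => wz zc.
  apply/setIdP; rewrite in_ball1; split=> //; case/orP: wz => // wz.
  have [m [i [pm offm lt_m wz']]] := first_hit v sc vc zc wz.
  have [j def_u] := cycP v uc; rewrite {1}def_u in auv.
  rewrite {1}def_u (off_cycle_walk (x0 := v) (i' := i) ne (m := v :: m)) /= ?auv //.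
  - by apply: within_leq wz'; lia.
  - by move=> w; rewrite inE => /predU1P[->|/offm].
  - by lia.
have [xc|xc] := boolP (x \in c); have [yc|yc] := boolP (y \in c); last first.
- have [||a ac ga] := gate (s := s) ne xc yc; [by rewrite axy orbT | by rewrite neq_xy |].
  apply: leq_trans (leq_trans (card_near_cycle (s := s.-1) ne _ ac) _); [|by lia|by lia].
  apply/subset_leq_card/subsetP => z /setIdP[]; rewrite in_ball2 => wz zc.
  by apply/setIdP; rewrite in_ball1 ga.
- by rewrite ball2C; apply: half => //; rewrite adj_sym.
- exact: half.
have consecutive i : #|[set z in ball s [:: cyc x c i; cyc x c i.+1] | z \in c]| <= 2 * s + 2.
  apply: (card_image_leq (f := fun j => cyc x c (i + j + s * (size c).-1))) => z.
  case/setIdP; rewrite in_ball2 => /orP[]wz zc; have le_sd : s <= d by lia.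
    by have [j le_j ->] := within_cycle ne le_sd zc wz; exists j => //; lia.
  have [j le_j ->] := within_cycle ne le_sd zc wz; exists j.+1; first by lia.
  by rewrite addSnnS.
have [i def_x] := cycP x xc; have [i' def_y] := cycP x yc.
have [||||_ [e|e]] := noexc_path ne (x0 := x) (i := i) (i' := i') (m := [::]).
- by rewrite /= -def_x -def_y axy.
- by rewrite /= inE !andbT -def_x -def_y.
- by [].
- exact: noexc_pos ne.
- by rewrite {1}def_x def_y e.
rewrite ball2C {1}def_x -(cyc_addn x c i) def_y e.
have -> : i + size c = (i + (size c).-1).+1 by case: sc; lia.
exact: consecutive.
Qed.

(** A walk from the tip [z] to [v'] first meets the cycle at [v], as otherwise it would complete the
    branch to an excursion. Reaching [v] already takes [t.+1] steps. *)
Lemma branch_tip (G : sgraph) (c : seq G) d t v y : no_excursion c d ->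
  v \in c -> y \notin c -> arc_to setT t v y -> t < d ->
  exists z, [/\ z \notin c, connect (@adj G) v z &
    forall s v', t.+1 + s <= d -> v' \in c -> within setT s v' z ->
      within setT (s - t.+1) v v'].
Proof.
move=> ne vc yc /andP[avy /exists_inP[z _ /andP[wyz nvz]]] lt_td.
have sc := noexc_shortest ne.
have [i def_v] := cycP v vc.
have /withinP[p [pp lp sp _]] := wyz.
have offp : {in p, forall w, w \notin c}.
  apply/hasPn; apply: contra nvz => hasp.
  move: pp lp sp; have [w m q /= wc /hasPn offm] := split_find hasp.
  rewrite cat_path last_cat last_rcons size_cat size_rcons => /andP[pm pq] lq sp.
  have [i' def_w] := cycP v wc.
  suff -> : v = w.
    apply: (@within_leq _ _ (size q)); first by apply: leq_trans sp; apply: leq_addl.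
    by rewrite -lq within_path.
  have lt_m : (size m).+1 <= t by apply: leq_trans sp; apply: leq_addr.
  rewrite def_w [LHS]def_v; apply: (off_cycle_walk ne (m := y :: m)) => //=.
  - by rewrite -def_v avy -def_w.
  - by move=> u; rewrite inE => /predU1P[->//|/offm].
  - exact: leq_ltn_trans lt_m lt_td.
have zc : z \notin c.
  by rewrite -lp; case: (p) offp => [|w q] offq //=; apply: offq; apply: mem_last.
exists z; split=> //.
  by apply: connect_trans (connect1 avy) _; apply: within_connect wyz.
move=> s v' le_d v'c; rewrite within_sym => wzv'.
have [m [i' [pm offm lt_m wz']]] := first_hit v sc zc v'c wzv'.
have e : cyc v c i = cyc v c i'.
  apply: (off_cycle_walk ne (m := y :: p ++ m)) => //=.
  - by rewrite -def_v avy rcons_cat cat_path pp lp.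
  - by move=> u; rewrite inE mem_cat => /or3P[/eqP->|/offp|/offm].
  - by rewrite size_cat; move: sp lt_m le_d; clear; lia.
rewrite -e -def_v in wz' pm.
apply: within_leq wz'; apply: leq_sub2l; rewrite ltnNge; apply: contra nvz => le_m.
rewrite within_sym; apply: within_leq le_m _.
by have := within_path pm; rewrite size_rcons last_rcons.
Qed.

(** * Counting in trees *)

Lemma dist_eq0 (G : sgraph) (x y : G) : connect (@adj G) x y -> dist x y = 0 -> x = y.
Proof. by move=> cxy e; have := leq_dist 0 cxy; rewrite e => /esym/eqP. Qed.

Lemma dist_step (G : sgraph) (x y : G) n : connected G -> dist x y = n.+1 ->
  exists x', adj x x' /\ dist x' y = n.
Proof.
move=> [_ conG] e; have /withinP[p [pp lp sp _]] : within setT n.+1 x y by rewrite -leq_dist // e.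
case: p pp lp sp => [|x' p] /= pp lp sp.
  by rewrite lp dist_refl in e.
case/andP: pp => axx' pp; exists x'; split=> //; apply/eqP; rewrite eqn_leq leq_dist //.
rewrite (within_leq (_ : size p <= n)) //=; last by rewrite -lp within_path.
by have := dist_adj axx' (conG x' y); rewrite e ltnS.
Qed.

Lemma arc_toP (G : sgraph) t (x y : G) : connected G -> arc_to setT t x y ->
  adj x y /\ exists w, dist y w = t /\ dist x w = t.+1.
Proof.
move=> [_ conG] /andP[axy /exists_inP[w _]]; rewrite -!leq_dist // => /andP[le1 lt2].
split=> //; exists w; have := dist_adj axy (conG y w); lia.
Qed.

(** In a tree a shortest path that starts away from [u] never turns towards [u]: at the turn, a
    vertex would have two neighbours closer to [u]. *)
Lemma tree_down (T : sgraph) (u x y w : T) : is_tree T -> adj x y ->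
  dist y u = (dist x u).+1 -> dist x w = (dist y w).+1 ->
  dist w u = dist y u + dist y w.
Proof.
move=> [conT acT]; have [_ con] := conT.
have [n def_n] : exists n, n = dist y w by exists (dist y w).
elim: n x y def_n => [|n IHn] x y def_n axy eyu exw.
  by rewrite -def_n addn0 (dist_eq0 (con y w)).
have [y' [ayy' ey'w]] := dist_step conT (esym def_n).
have [eyy'|ey'y] := dist_adj_cases acT ayy' (con y u).
  suff e : x = y' by rewrite e ey'w in exw; lia.
  apply: (@closer_unique T (dist x u) y x y' u) => //; first by rewrite adj_sym.
  - by rewrite -leq_dist.
  - by rewrite -leq_dist //; lia.
  - by rewrite -leq_dist // eyu ltnn.
rewrite (IHn y y') //; lia.
Qed.

(** Both [x] and [x'] are the vertex [r] steps from [w] on the unique path to [u]. *)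
Lemma tree_ancestor (T : sgraph) (u x x' w : T) r : is_tree T ->
  dist w x = r -> dist w x' = r ->
  dist w u = dist x u + r -> dist w u = dist x' u + r -> x = x'.
Proof.
move=> [conT acT]; have [_ con] := conT.
elim: r w => [|r IHr] w ex ex' eu eu'.
  by rewrite -(dist_eq0 (con w x) ex) -(dist_eq0 (con w x') ex').
have [w1 [a1 e1]] := dist_step conT ex; have [w2 [a2 e2]] := dist_step conT ex'.
have t1 := dist_triangle (con w1 x) (con x u); have t2 := dist_triangle (con w2 x') (con x' u).
have d1 := dist_adj a1 (con w1 u).
have e12 : w1 = w2.
  apply: (@closer_unique T (dist x u + r) w w1 w2 u) => //; rewrite -leq_dist //; lia.
by apply: (IHr w1) => //; [rewrite e12 | lia | lia].
Qed.

Lemma card_leq_rel (I J : finType) (A : {set I}) (B : {set J}) (R : I -> J -> bool) :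
  (forall x, x \in A -> exists2 y, y \in B & R x y) ->
  (forall x x' y, R x y -> R x' y -> x = x') -> #|A| <= #|B|.
Proof.
move=> exR injR; pose f x := [pick y in B | R x y].
have fP x : x \in A -> exists2 y, f x = Some y & (y \in B) && R x y.
  move=> /exR[y yB Rxy]; rewrite /f; case: pickP => [y' Ry'|none]; first by exists y'.
  by have := none y; rewrite /= yB Rxy.
rewrite -(@card_in_imset _ _ f A) => [|x x' /fP[y -> /andP[_ Rxy]] /fP[y' -> /andP[_ Rxy']] [e]].
  have some_inj : injective (@Some J) by move=> y y' [].
  rewrite -(card_imset (mem B) some_inj); apply/subset_leq_card/subsetP => _ /imsetP[x /fP[y -> /andP[yB _]] ->].
  by apply/imsetP; exists y.
by apply: injR Rxy _; rewrite e.
Qed.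

(* Going [t + 1] steps away from the root [u] leaves the ball, and the vertex
   reached determines the starting point. *)
Lemma tree_centers (T : sgraph) t (u v : T) : is_tree T -> adj u v ->
  #|[set x : T | 1 < legs setT t x]| <= 2 + (#|T| - #|ball t.+1 [:: u; v]|).
Proof.
move=> treeT auv; have [conT acT] := treeT; have [_ con] := conT.
have -> : #|T| - #|ball t.+1 [:: u; v]| = #|~: ball t.+1 [:: u; v]|.
  by rewrite -(cardsC (ball t.+1 [:: u; v])) addKn.
have neq_uv : u != v by apply: contraTneq auv => ->; rewrite adj_irrefl.
rewrite -(cardsID [set u; v]) leq_add //.
  by apply: leq_trans (subset_leq_card (subsetIr _ _)) _; rewrite cards2 neq_uv.
pose R x w := (dist w x == t.+1) && (dist w u == dist x u + t.+1).
apply: (@card_leq_rel _ _ _ _ R) => [x|x x' w]; last first.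
  move=> /andP[/eqP e1 /eqP e2] /andP[/eqP e3 /eqP e4].
  exact: (tree_ancestor treeT e1 e3 e2 e4).
rewrite !inE negb_or => /andP[/andP[neq_xu neq_xv] /card_gt1P[y1 [y2 []]]].
rewrite !inE => arc1 arc2 neq_y.
(* At most one neighbour of [x] is closer to [u], so one of the two legs leads away from [u]. *)
have [y [arcy eyu]] : exists y, arc_to setT t x y /\ dist y u = (dist x u).+1.
  have [a1 _] := arc_toP conT arc1; have [a2 _] := arc_toP conT arc2.
  have [e1|e1] := dist_adj_cases acT a1 (con x u); last by exists y1.
  have [e2|e2] := dist_adj_cases acT a2 (con x u); last by exists y2.
  case/eqP: neq_y; apply: (@closer_unique T (dist y1 u) x y1 y2 u) => //;
    by rewrite -leq_dist //; lia.
have [axy [w [eyw exw]]] := arc_toP conT arcy.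
have ewu : dist w u = dist x u + t.+1.
  by rewrite (tree_down treeT axy eyu) ?exw ?eyw //; lia.
have ewx : dist w x = t.+1 by rewrite dist_sym.
exists w; last by rewrite /R ewu ewx !eqxx.
have xu_gt0 : 0 < dist x u.
  by rewrite lt0n; apply: contra neq_xu => /eqP/(dist_eq0 (con x u))->.
rewrite !inE /within_root /= orbF negb_or -!leq_dist // -!ltnNge (dist_sym u) ewu.
apply/andP; split; first by lia.
(* If [w] were within [t.+1] of [v], then [v] would lie on the path from [w] to [u] at distance
   [t.+1] from [w], as [x] does, whence [x = v]. *)
rewrite (dist_sym v) ltnNge; apply/negP => le_wv.
have d_uv : dist v u = 1.
  have := dist_adj (_ : adj v u) (con u u); rewrite adj_sym dist_refl => /(_ auv).
  case: (dist v u) (@dist_eq0 T v u (con v u)) => [/(_ erefl) e|[|]//].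
  by rewrite e eqxx in neq_uv.
have := dist_triangle (con w v) (con v u); rewrite d_uv => tri.
case/eqP: neq_xv; apply: (@tree_ancestor T u x v w t.+1) => //; lia.
Qed.

(** Of the two orientations, take the one leading away from [v]. Its head [y] is a leg of [v], or
    [t] further steps from [y] lead to a vertex outside the ball, and that vertex determines [y]. *)
Lemma tree_central_arcs (T : sgraph) t (v : T) : is_tree T ->
  #|[set p : T * T | adj p.1 p.2 && (arc_to setT t p.1 p.2 && arc_to setT t p.2 p.1)]|
  <= 2 * (legs setT t v + (#|T| - #|ball t.+1 [:: v]|)).
Proof.
move=> treeT; have [conT acT] := treeT; have [_ con] := conT.
have -> : #|T| - #|ball t.+1 [:: v]| = #|~: ball t.+1 [:: v]|.
  by rewrite -(cardsC (ball t.+1 [:: v])) addKn.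
set A := [set p | _].
pose X := [set y | [exists x, arc_to setT t x y && (dist y v == (dist x v).+1)]].
have le_X : #|X| <= legs setT t v + #|~: ball t.+1 [:: v]|.
  rewrite -(cardsID [set y in setT | arc_to setT t v y]) leq_add //.
    exact: subset_leq_card (subsetIr _ _).
  pose R y w := (dist w y == t) && (dist w v == dist y v + t).
  apply: (@card_leq_rel _ _ _ _ R) => [y|y y' w]; last first.
    move=> /andP[/eqP e1 /eqP e2] /andP[/eqP e3 /eqP e4].
    exact: (tree_ancestor treeT e1 e3 e2 e4).
  rewrite in_setD !in_set => /andP[narc /existsP[x /andP[arcx /eqP eyv]]].
  have [axy [w [eyw exw]]] := arc_toP conT arcx.
  have ewv : dist w v = dist y v + t.
    by rewrite (tree_down treeT axy eyv) ?exw ?eyw.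
  have ewy : dist w y = t by rewrite dist_sym.
  exists w; last by rewrite /R ewv ewy !eqxx.
  rewrite in_setC in_ball1 -leq_dist // -ltnNge dist_sym ewv eyv.
  suff : 0 < dist x v by lia.
  rewrite lt0n; apply: contra narc => /eqP/(dist_eq0 (con x v)) <-.
  exact: arcx.
pose D := [set p in A | dist p.2 v == (dist p.1 v).+1].
have le_D : #|D| <= #|X|.
  rewrite -(@card_in_imset _ _ snd D).
    apply/subset_leq_card/subsetP => q /imsetP[[x y] /setIdP[]].
    rewrite inE /= => /andP[_ /andP[arcx _]] eyv ->.
    by rewrite inE; apply/existsP; exists x; rewrite arcx eyv.
  move=> [x y] [x' y'] /[!inE]/= /andP[/andP[axy _] /eqP e1].
  move=> /andP[/andP[axy' _] /eqP e2] ey.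
  rewrite -{}ey in axy' e2 *; congr (_, _).
  apply: (@closer_unique T (dist x v) y x x' v) => //; rewrite -?leq_dist // 1?adj_sym //.
    by move: e2; rewrite e1 => -[->].
  by rewrite e1 ltnn.
have swap_inj : injective (fun p : T * T => (p.2, p.1)) by move=> [a b] [a' b'] [-> ->].
apply: (@leq_trans #|D :|: [set (p.2, p.1) | p in D]|); last first.
  apply: leq_trans (leq_card_setU _ _) _; rewrite (card_imset _ swap_inj).
  by have := leq_trans le_D le_X; lia.
apply/subset_leq_card/subsetP => -[x y] pA; rewrite in_setU.
have /[!inE]/= /andP[axy /andP[arc1 arc2]] := pA.
have [e|e] := dist_adj_cases acT axy (con x v); apply/orP; [right|left].
  apply/imsetP; exists (y, x) => //; apply/setIdP; split; last by rewrite /= e.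
  by rewrite inE /= adj_sym axy arc1 arc2.
by rewrite axy arc1 arc2 e eqxx.
Qed.

(** * Star-shaped sets *)

Definition star_set (G : sgraph) r (s : seq G) (S : {set G}) : bool :=
  [forall z in S, within_root S r s z].

Lemma star_setP (G : sgraph) r (s : seq G) (S : {set G}) :
  reflect (forall z, z \in S -> exists2 x, x \in s & within S r x z) (star_set r s S).
Proof.
by apply: (iffP forall_inP) => st z /st => [/hasP|] // [x xs wxz]; apply/hasP; exists x.
Qed.

Lemma ball_star_set (G : sgraph) r (s : seq G) : star_set r s (ball r s).
Proof.
apply/star_setP => z; rewrite inE => /hasP[x xs wxz]; exists x => //.
exact: within_ball.
Qed.

(** Vertices are added one at a time: on a walk in [S'] from the root to a vertex outside [S], the
    first vertex outside [S] can be added. *)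
Lemma star_interpolate (G : sgraph) r (s : seq G) (S S' : {set G}) k :
  {subset s <= S} -> S \subset S' -> star_set r s S -> star_set r s S' ->
  #|S| <= k <= #|S'| ->
  exists K : {set G}, [/\ S \subset K, K \subset S', #|K| = k & star_set r s K].
Proof.
have [n le_n] := ubnP (k - #|S|); elim: n S le_n => // n IHn S le_n sS subSS' stS stS'.
case/andP=> le_Sk le_kS'; have [eq_k|neq_k] := eqVneq #|S| k.
  by exists S; split.
have lt_Sk : #|S| < k by rewrite ltn_neqAle neq_k.
have [w wS' wS] : exists2 w, w \in S' & w \notin S.
  apply/subsetPn; apply: contraL lt_Sk => /subset_leq_card le_S'.
  by rewrite -leqNgt; apply: leq_trans le_kS' le_S'.
have [x xs /withinP[p [pp lp sp Dp]]] := star_setP _ _ _ stS' w wS'.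
have hasp : has [pred u | u \notin S] p.
  apply/hasP; exists w => //; rewrite -lp; case: p lp {pp sp Dp} => [e|y p _] /=.
    by rewrite -e sS in wS.
  exact: mem_last.
move: pp sp Dp {lp}; have [u m q /= uS /hasPn offm] := split_find hasp.
rewrite cat_path size_cat size_rcons => /andP[pm _] sp Dp.
have le_m : (size m).+1 <= r by apply: leq_trans sp; apply: leq_addr.
have mS y : y \in m -> y \in S by move=> /offm /=; rewrite negbK.
have [||||||K [subK KS' cardK stK]] := IHn (u |: S).
- by rewrite cardsU1 uS; move: le_n lt_Sk; clear; lia.
- by move=> y /sS yS; rewrite inE yS orbT.
- rewrite subUset sub1set subSS' andbT; apply: Dp.
  by rewrite mem_cat mem_rcons mem_head.
- apply/star_setP => y; rewrite in_setU1 => /predU1P[->|yS].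
    exists x => //; apply/withinP; exists (rcons m u).
    rewrite pm last_rcons size_rcons; split=> // v; rewrite mem_rcons inE.
    by rewrite in_setU1 => /predU1P[->|/mS->]; rewrite ?eqxx ?orbT.
  have [v vs wvy] := star_setP _ _ _ stS y yS; exists v => //.
  by apply: within_mono (leqnn r) wvy; apply: subsetUr.
- exact: stS'.
- by rewrite cardsU1 uS lt_Sk.
by exists K; split=> //; apply: subset_trans subK; apply: subsetUr.
Qed.

(* A vertex at maximal distance is not an inner vertex of a shortest path. *)
Lemma star_remove (G : sgraph) t (v z : G) (S : {set G}) :
  star_set t.+1 [:: v] S -> ~~ within setT t v z -> star_set t.+1 [:: v] (S :\ z).
Proof.
move=> /star_setP stS nvz; apply/star_setP => w; rewrite !inE => /andP[neq_wz wS].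
exists v; first by rewrite inE.
have [x] := stS w wS; rewrite inE => /eqP-> /withinP[p [pp lp sp Dp]].
apply/withinP; exists p; split=> // u up; rewrite !inE Dp // andbT.
apply: contra nvz => /eqP def_u; move: up; rewrite {}def_u => zp.
case/splitPr: p / zp pp lp sp {Dp} => p1 p2.
rewrite -cat_rcons cat_path last_cat last_rcons size_cat size_rcons => /andP[pz _] lp sp.
case: p2 lp sp => [/= e|y p2 _ /= sp]; first by rewrite e eqxx in neq_wz.
have := within_path pz; rewrite last_rcons; apply: within_leq.
by rewrite size_rcons; lia.
Qed.

Lemma arc_leg (G : sgraph) t (v y : G) : arc_to setT t v y ->
  adj v y /\ exists q, [/\ path (@adj G) y q, size q = t & ~~ within setT t v (last y q)].
Proof.
case/andP=> avy /exists_inP[z _ /andP[/withinP[q [pq lq sq _]] nvz]].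
split=> //; exists q; rewrite lq; split=> //; apply/eqP; rewrite eqn_leq sq leqNgt.
apply: contra nvz => lt_q; apply: within_leq lt_q _.
by apply: within_cons (in_setT y) avy _; rewrite -lq within_path.
Qed.

(** The three legs without the tip of the first form a star with at most [k] vertices, and the ball
    without this tip has at least [k]; interpolation gives [K]. The missing tip tells apart the sets
    obtained by permuting the legs. *)
Lemma three_legs_star (T : sgraph) t k (v : T) (y1 y2 y3 : T) (q1 q2 q3 : seq T) :
  acyclic T -> (forall x y : T, adj x y -> #|ball t [:: x; y]| < k) ->
  k < #|ball t.+1 [:: v]| -> (t = 0 -> 4 <= k) ->
  [/\ y1 != y2, y2 != y3 & y3 != y1] ->
  [/\ adj v y1, path (@adj T) y1 q1, size q1 = t & ~~ within setT t v (last y1 q1)] ->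
  [/\ adj v y2, path (@adj T) y2 q2, size q2 = t & ~~ within setT t v (last y2 q2)] ->
  [/\ adj v y3, path (@adj T) y3 q3, size q3 = t & ~~ within setT t v (last y3 q3)] ->
  exists K : {set T}, [/\ #|K| = k, v \in K, star_set t.+1 [:: v] K, 2 < legs K t.-1 v &
    [/\ last y1 q1 \notin K, last y2 q2 \in K & last y3 q3 \in K]].
Proof.
move=> acT small_edges big_ball k4 [n12 n23 n31] leg1 leg2 leg3.
pose z1 := last y1 q1.
pose L := v |: [set w in (y1 :: q1) ++ (y2 :: q2) ++ (y3 :: q3)].
have inL u p w : [/\ adj v u, path (@adj T) u p, size p = t & ~~ within setT t v (last u p)] ->
    {subset u :: p <= L} -> w \in u :: p -> within L t.+1 v w.
  move=> [avu pp sp _] subp wp; case/splitPl: p / wp pp sp subp => p1 p2 lp1.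
  rewrite cat_path size_cat => /andP[pp1 _] sp subp.
  apply/withinP; exists (u :: p1); rewrite /= avu pp1 lp1; split=> //; first by lia.
  by move=> x xp; apply: subp; rewrite -cat_cons mem_cat xp.
have sub1 : {subset y1 :: q1 <= L} by move=> w wp; rewrite in_setU1 inE !mem_cat wp !orbT.
have sub2 : {subset y2 :: q2 <= L} by move=> w wp; rewrite in_setU1 inE !mem_cat wp !orbT.
have sub3 : {subset y3 :: q3 <= L} by move=> w wp; rewrite in_setU1 inE !mem_cat wp !orbT.
have starL : star_set t.+1 [:: v] L.
  apply/star_setP => w; rewrite in_setU1 inE !mem_cat.
  by case/predU1P=> [->|/or3P[] wp]; exists v; rewrite ?mem_head ?within0 //;
    [apply: inL leg1 sub1 wp | apply: inL leg2 sub2 wp | apply: inL leg3 sub3 wp].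
have nvz1 : ~~ within setT t v z1 by case: leg1.
have v_neq z : ~~ within setT t v z -> v != z by apply: contraNneq => <-; apply: within0.
have neq_last u p u' p' : u != u' ->
    [/\ adj v u, path (@adj T) u p, size p = t & ~~ within setT t v (last u p)] ->
    [/\ adj v u', path (@adj T) u' p', size p' = t & ~~ within setT t v (last u' p')] ->
    last u p != last u' p'.
  move=> neq [avu pp sp nw] [avu' pp' sp' _]; apply: contra neq => /eqP e; apply/eqP.
  apply: (closer_unique acT avu avu' (t := t) (z := last u p)) => //.
    by rewrite -{1}sp within_path.
  by rewrite e -sp' within_path.
have subLB : L :\ z1 \subset ball t.+1 [:: v] :\ z1.
  apply/setSD/subsetP => w wL; rewrite in_ball1.
  by have [x] := star_setP _ _ _ starL w wL; rewrite inE => /eqP->; apply: within_setT.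
(* The first and third legs without their tips lie within [t] of [v], and the second within [t] of
   [y2]. Hence all but the tip of the third leg lie in the ball around this edge, which has fewer
   than [k] vertices. *)
have card_L : #|L :\ z1| <= k.
  have lt_E := small_edges v y2 (let: And4 a _ _ _ := leg2 in a).
  apply: leq_trans lt_E; apply: leq_trans (_ : #|last y3 q3 |: ball t [:: v; y2]| <= _); last first.
    by rewrite cardsU1; case: (_ \notin _) => /=; lia.
  apply/subset_leq_card/subsetP => w; rewrite in_setD1 in_setU1 in_ball2 in_setU1 inE !mem_cat.
  have short u p : [/\ adj v u, path (@adj T) u p, size p = t & ~~ within setT t v (last u p)] ->
      w \in u :: p -> w != last u p -> within setT t v w.
    move=> [avu pp sp _] wp neq; case/splitPl: p / wp pp sp neq => p1 p2 lp1.
    rewrite cat_path size_cat last_cat lp1 => /andP[pp1 _] sp neq.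
    case: p2 sp neq => [_|x p2 /= sp _]; first by rewrite /= eqxx.
    have := within_path (_ : path (@adj T) v (u :: p1)); rewrite /= avu lp1 => /(_ pp1).
    by apply: within_leq; lia.
  have along u p : path (@adj T) u p -> size p = t -> w \in u :: p -> within setT t u w.
    move=> pp sp wp; case/splitPl: p / wp pp sp => p1 p2 <-.
    rewrite cat_path size_cat => /andP[pp1 _] sp.
    by apply: within_leq (within_path pp1); lia.
  case/andP=> neq_w /predU1P[->|/or3P[] wp]; first by rewrite within0 orbT.
  - by rewrite (short y1 q1) ?orbT.
  - by case: leg2 => _ pq sq _; rewrite (along y2 q2) ?orbT.
  - by have [//|neq3] := eqVneq w (last y3 q3); rewrite (short y3 q3) ?orbT.
have z1B : z1 \in ball t.+1 [:: v].
  have [avy pq sq _] := leg1; rewrite in_ball1.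
  by apply: within_cons (in_setT y1) avy _; rewrite -sq within_path.
have le_kB : k <= #|ball t.+1 [:: v] :\ z1|.
  by move: big_ball; rewrite (cardsD1 z1) z1B; lia.
have vL1 : v \in L :\ z1 by rewrite in_setD1 v_neq //= setU11.
have [|||||K [subLK subKB cardK starK]] := @star_interpolate T t.+1 [:: v] (L :\ z1)
    (ball t.+1 [:: v] :\ z1) k.
- by move=> x; rewrite inE => /eqP->.
- exact: subLB.
- exact: star_remove.
- by apply: star_remove => //; apply: ball_star_set.
- by rewrite card_L.
have vK : v \in K by apply: (subsetP subLK).
have z1K : z1 \notin K by apply: contraTN isT => /(subsetP subKB); rewrite in_setD1 eqxx.
exists K; split=> //; last first.
  split=> //; apply: (subsetP subLK); rewrite in_setD1.
    by rewrite eq_sym (neq_last _ _ _ _ n12 leg1 leg2) sub2 // mem_last.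
  by rewrite (neq_last _ _ _ _ n31 leg3 leg1) sub3 // mem_last.
(* For [t = 0] the first leg has lost its only vertex. Every vertex of [K] other than [v] is then a
   leg, and [4 <= k] provides three. *)
case: (posnP t) => [t0|t_gt0].
  have sub_legs : K :\ v \subset [set y in K | arc_to K t.-1 v y].
    apply/subsetP => y; rewrite !inE => /andP[neq_y yK]; rewrite yK /=.
    have [x] := star_setP _ _ _ starK y yK; rewrite inE t0 => /eqP->.
    case/withinP=> -[|w [|w' p]] [] //= avw ey _ _; first by rewrite ey eqxx in neq_y.
    rewrite -ey andbT in avw *; rewrite /arc_to avw; apply/exists_inP; exists w; first by rewrite ey.
    rewrite within0 /=; apply/negP => /withinP[[|u p] [] //= _ evw _ _].
    by rewrite evw ey eqxx in neq_y.
  apply: leq_trans (subset_leq_card sub_legs).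
  by have := k4 t0; rewrite -cardK (cardsD1 v) vK.
have leg_arc u p : [/\ adj v u, path (@adj T) u p, size p = t & ~~ within setT t v (last u p)] ->
    {subset u :: p <= L} -> u \in [set y in K | arc_to K t.-1 v y].
  move=> [avu pp sp nw] subp.
  case/lastP: p => [|p w] in pp sp nw subp *; first by rewrite -sp in t_gt0.
  rewrite rcons_path in pp; case/andP: pp => pp aw; rewrite size_rcons in sp.
  rewrite last_rcons in nw.
  have subpK x : x \in u :: p -> x \in K.
    move=> xp; apply: (subsetP subLK); rewrite in_setD1 subp; last first.
      by rewrite -rcons_cons mem_rcons inE xp orbT.
    rewrite andbT; apply: contraNneq nvz1 => <-; case/splitPl: p / xp pp sp {aw subp} => p1 p2 lp1.
    rewrite cat_path size_cat => /andP[pp1 _] sp.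
    have := within_path (_ : path (@adj T) v (u :: p1)); rewrite /= avu lp1 => /(_ pp1).
    by apply: within_leq; rewrite -sp ltnS leq_addr.
  rewrite inE subpK ?mem_head // /arc_to avu /=; apply/exists_inP.
  exists (last u p); first by apply: subpK; apply: mem_last.
  apply/andP; split.
    apply/withinP; exists p; split=> //; first by rewrite -sp.
    by move=> x xp; apply: subpK; rewrite inE xp orbT.
  apply: contra nw => /within_setT wv; rewrite -(prednK t_gt0) -addn1.
  apply: within_trans wv (within_adj (in_setT w) aw).
apply/card_gt2P; exists y1, y2, y3; split=> //; split.
- exact: leg_arc leg1 sub1.
- exact: leg_arc leg2 sub2.
- exact: leg_arc leg3 sub3.
Qed.

(** * Ambiguous pairs *)

Lemma ucycle_pattern (G H : sgraph) (s : seq G) (t : seq H) :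
  pattern s = pattern t -> uniq t -> ucycle (@adj G) s -> ucycle (@adj H) t.
Proof.
move=> eqp ut /andP[cs us]; rewrite /ucycle ut andbT; have eqs := size_pattern eqp.
case: t => [//|y0 t] in eqp ut eqs *.
have def_t : y0 :: t = [seq nth y0 (y0 :: t) (index x s) | x <- s].
  apply: (@eq_from_nth _ y0) => [|i lti]; first by rewrite size_map -eqs.
  have [x0 _] : exists x0 : G, true by case: (s) eqs => // x0 s' _; exists x0.
  by rewrite (nth_map x0) ?eqs // index_uniq ?eqs.
rewrite def_t; apply: (homo_cycle_in (P := mem s)) cs; last by apply/allP.
move=> x x' xs xs' axx'.
by rewrite -(pattern_nth x y0 eqp) ?index_mem // !nth_index.
Qed.

(** The situation to be refuted, with [k = n - l]. The field [amb_exn] reflects the exclusion of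
    [(n, l) = (5, 2)]. *)
Record ambiguous (G T : sgraph) (c : seq G) (z : G) (k : nat) : Prop := Ambiguous {
  amb_tree : is_tree T;
  amb_card : #|G| = #|T|;
  amb_npat : forall A, npat G k A = npat T k A;
  amb_lt : #|G| < 2 * k;
  amb_exn : k = 3 -> #|G| <> 5;
  amb_short : shortest c;
  amb_girth : k < size c;
  amb_comp : forall x, x \in c -> ~~ connect (@adj G) z x }.

(** Patterns on two vertices give the number of edges, so [tree_dichotomy] applies. A cycle with at
    most [k] vertices would have a pattern that also occurs in [T]. *)
Lemma not_tree_ambiguous (G T : sgraph) k : is_tree T -> #|G| = #|T| ->
  (forall A, npat G k A = npat T k A) -> #|G| < 2 * k -> 1 < k <= #|G| ->
  (k = 3 -> #|G| <> 5) -> is_tree G \/ exists (c : seq G) (z : G), ambiguous T c z k.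
Proof.
move=> treeT eqn eqk lt_n /andP[lt1k le_kn] exn.
have eq2 := npat2_arcs (npat_leq eqn le_kn lt1k eqk).
have [||treeG|[c [z [cc lt2 min_c comp]]]] := @tree_dichotomy G; [by lia | | by left |].
  by rewrite eq2 (tree_arcs treeT) eqn.
right; exists c, z; split=> //; rewrite ltnNge; apply/negP => le_c.
have uc : uniq c by case/andP: cc.
have : 0 < npat G (size c) (pattern c).
  by apply/card_gt0P; exists (in_tuple c); rewrite inE uc eqxx.
rewrite (npat_leq eqn le_kn le_c eqk) => /card_gt0P[t /[!inE]/andP[ut /eqP pt]].
case: treeT => _ /(_ t); rewrite size_tuple => /(_ lt2); apply.
exact: ucycle_pattern (esym pt) ut cc.
Qed.

Lemma amb_sum (G T : sgraph) (c : seq G) z k : ambiguous T c z k ->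
  size c + #|component z| <= #|G| /\ 0 < #|component z|.
Proof.
move=> amb; have uc : uniq c by case: (amb_short amb) => /andP[].
split; last by apply/card_gt0P; exists z; rewrite inE connect0.
rewrite -(card_uniqP uc) -(cardsE (mem c)) -cardsUI.
rewrite [X in _ + #|pred_of_set X|](_ : _ = set0) ?cards0 ?addn0 ?max_card //.
apply/setP => x; rewrite !inE; apply/negP => /andP[xc].
exact/negP/(amb_comp amb).
Qed.

(** The ball contains a star on exactly [k] vertices with the same root. Its pattern occurs in [T],
    where the star again lies in the ball of its root. *)
Lemma visible_big (G T : sgraph) b r k (s : seq G) :
  (forall A, npat G k A = npat T k A) -> b < k -> uniq s -> rooted b s ->
  k <= #|ball r s| -> exists2 s' : b.+1.-tuple T, rooted b s' & k <= #|ball r s'|.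
Proof.
move=> eqk lt_bk us rs big; have /andP[/eqP ss _] := rs.
have card_s : #|[set x in s]| = b.+1 by rewrite cardsE (card_uniqP us).
have [|||||K [sK _ cardK stK]] := @star_interpolate G r s [set x in s] (ball r s) k.
- by move=> x xs; rewrite inE.
- apply/subsetP => x; rewrite !inE => xs; apply/hasP; exists x => //.
  exact: within0.
- by apply/star_setP => x; rewrite inE => xs; exists x => //; apply: within0.
- exact: ball_star_set.
- by rewrite card_s lt_bk.
pose t := s ++ enum (K :\: [set x in s]).
have ut : uniq t.
  rewrite cat_uniq us enum_uniq andbT; apply/hasPn => x.
  by rewrite mem_enum !inE => /andP[].
have setK : [set x in t] = K.
  apply/setP => x; rewrite inE mem_cat mem_enum !inE.
  by case: (boolP (x \in s)) => //= xs; rewrite (subsetP sK) // inE.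
have st : size t == k by rewrite -cardK -setK cardsE (card_uniqP ut).
have take_t : take b.+1 t = s by rewrite take_size_cat.
have start : star b r t.
  rewrite /star take_t rs setK /=; apply/allP => x xt.
  by apply: (forall_inP stK); rewrite -setK inE.
have : 0 < npat G k (pattern t).
  by apply/card_gt0P; exists (Tuple st); rewrite inE /= ut eqxx.
rewrite eqk => /card_gt0P[t' /[!inE]/andP[ut' /eqP pt']].
have start' : star b r t' by rewrite (star_pattern b r pt' ut' ut).
have /andP[rt' _] := start'.
have sz : size (take b.+1 t') == b.+1 by case/andP: rt'.
exists (Tuple sz) => //=; rewrite -{1}(size_tuple t'); exact: star_leq_ball.
Qed.

Lemma amb_long_cycles (G T : sgraph) (c : seq G) z k : ambiguous T c z k ->
  forall c', ucycle (@adj G) c' -> 2 < size c' -> #|component z| < size c'.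
Proof.
move=> amb c' cc' lt2; have [_ _ min_c] := amb_short amb.
apply: leq_trans (min_c c' cc' lt2).
have [] := amb_sum amb; have := amb_lt amb; have := amb_girth amb; lia.
Qed.

Lemma amb_leq (G T : sgraph) (c : seq G) z k : ambiguous T c z k -> k < #|G|.
Proof.
by move=> amb; have [] := amb_sum amb; have := amb_girth amb; lia.
Qed.

(** In [T] every vertex has a leg, since no ball is the whole tree. The number of such vertices is
    visible, so all vertices of [G] have one too. *)
Lemma amb_legs (G T : sgraph) (c : seq G) z k t : ambiguous T c z k ->
  (forall x : G, #|ball t.+1 [:: x]| <= k) -> (forall x : T, #|ball t.+1 [:: x]| <= k) ->
  forall x : G, 0 < legs setT t x.
Proof.
move=> amb ballG ballT x; have lt_kn := amb_leq amb.
have := @visible_vertices G T t k (fun m => 0 < m) (amb_card amb) (ltnW lt_kn)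
  (amb_npat amb) ballG ballT.
have -> : [set x : T | 0 < legs setT t x] = setT.
  apply/setP => y; rewrite !inE; have [conT _] := amb_tree amb.
  apply: connected_legs conT _; rewrite -(amb_card amb).
  exact: leq_ltn_trans (ballT y) lt_kn.
rewrite cardsT -(amb_card amb) -cardsT => /eqP; rewrite eq_sym eqn_leq => /andP[le _].
have /setP/(_ x) : [set x : G | 0 < legs setT t x] = setT.
  by apply/eqP; rewrite eqEcard subsetT.
by rewrite !inE.
Qed.

Lemma amb_component_even (G T : sgraph) (c : seq G) z k t : ambiguous T c z k ->
  (forall x : G, #|ball t.+1 [:: x]| <= k) -> (forall x : T, #|ball t.+1 [:: x]| <= k) ->
  2 * t.+1 <= #|component z|.
Proof.
move=> amb ballG ballT; apply: component_even; first exact: amb_legs amb ballG ballT.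
exact: amb_long_cycles amb.
Qed.

(** By [tree_far_edge] no edge of [T] lacks a far side, and the number of edges lacking one is
    visible. *)
Lemma amb_component_odd (G T : sgraph) (c : seq G) z k t : ambiguous T c z k ->
  (forall x : G, #|ball t.+1 [:: x]| <= k) -> (forall x : T, #|ball t.+1 [:: x]| <= k) ->
  (forall x y : G, adj x y -> #|ball t.+1 [:: x; y]| <= k) ->
  (forall x y : T, adj x y -> #|ball t.+1 [:: x; y]| <= k) ->
  2 * t.+1 + 1 <= #|component z|.
Proof.
move=> amb ballG ballT edgeG edgeT; have lt_kn := amb_leq amb.
apply: component_odd; [exact: amb_legs amb ballG ballT | | exact: amb_long_cycles amb].
move=> x y axy; apply/negPn/negP => none.
have := @visible_edges G T t.+1 k (fun a b => ~~ (a || b)) (amb_card amb) (ltnW lt_kn)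
  (amb_npat amb) edgeG edgeT.
have -> : [set p : T * T | adj p.1 p.2 &&
    ~~ (arc_to setT t.+1 p.1 p.2 || arc_to setT t.+1 p.2 p.1)] = set0.
  apply/setP => -[u v]; rewrite !inE /=; apply/negP => /andP[auv /negP none']; apply: none'.
  apply: (tree_far_edge (amb_tree amb) auv); rewrite -(amb_card amb).
  exact: leq_ltn_trans (edgeT u v auv) lt_kn.
move=> /eqP; rewrite cards0 cards_eq0 => /eqP/setP/(_ (x, y)).
by rewrite !inE /= axy none.
Qed.

(** A set inside one component misses the cycle, or it lies in the component of the cycle and misses
    that of [z]; then it splits into its part on the cycle and its part in [U]. *)
Lemma ball_cycle_bound (G T : sgraph) (c : seq G) z k (B : {set G}) : ambiguous T c z k ->
  {in B &, forall x y, connect (@adj G) x y} ->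
  let U := ~: ([set x in c] :|: component z) in
  #|B| + size c <= #|G| \/
  #|B| = #|[set x in B | x \in c]| + #|B :&: U| /\ #|U| + size c + #|component z| = #|G|.
Proof.
move=> amb conB U; have uc : uniq c by case: (amb_short amb) => /andP[].
have card_c : #|[set x in c]| = size c by rewrite cardsE (card_uniqP uc).
have disj : [set x in c] :&: component z = set0.
  by apply/setP => x; rewrite !inE; apply/negP => /andP[xc]; apply/negP/(amb_comp amb).
have card_U : #|U| + size c + #|component z| = #|G|.
  have := cardsC ([set x in c] :|: component z); rewrite -/U cardsU disj cards0 card_c.
  by lia.
have [B0|[x /setIdP[xB xc]]] := set_0Vmem [set x in B | x \in c].
  left; have B0' : B :&: [set x in c] = set0 by rewrite -B0; apply/setP => x; rewrite !inE.
  by rewrite -card_c -cardsUI B0' cards0 addn0 max_card.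
right; split=> //; rewrite -(cardsID [set x in c] B); congr (_ + _).
  by apply: eq_card => y; rewrite !inE.
apply: eq_card => y; rewrite !inE negb_or andbC; have [yB|//] := boolP (y \in B).
rewrite /= [X in _ = _ && X](_ : _ = true) ?andbT //.
have := amb_comp amb xc; apply: contra => zy; apply: connect_trans zy _.
exact: conB.
Qed.

Lemma ball1_connect (G : sgraph) r (x : G) :
  {in ball r [:: x] &, forall u w, connect (@adj G) u w}.
Proof.
move=> u w; rewrite !in_ball1 => /within_connect cu /within_connect cw.
by apply: connect_trans cw; rewrite connect_adj_sym.
Qed.

Lemma ball2_connect (G : sgraph) r (x y : G) : adj x y ->
  {in ball r [:: x; y] &, forall u w, connect (@adj G) u w}.
Proof.
move=> axy u w; rewrite !in_ball2.
have con v : within setT r x v || within setT r y v -> connect (@adj G) x v.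
  case/orP=> /within_connect // cyv; exact: connect_trans (connect1 axy) cyv.
by move=> /con cu /con cw; apply: connect_trans cw; rewrite connect_adj_sym.
Qed.

Lemma ball_edge_bound (G T : sgraph) (c : seq G) z k d s (x y : G) : ambiguous T c z k ->
  no_excursion c d -> 2 * s + 1 <= d -> adj x y ->
  #|ball s [:: x; y]| + size c + #|component z| <= #|G| + (2 * s + 2) \/
  #|ball s [:: x; y]| + size c <= #|G|.
Proof.
move=> amb ne le_d axy; have := card_ball_edge ne le_d axy.
have := ball_cycle_bound amb (ball2_connect (r := s) axy); cbv zeta.
case=> [|[-> <-] le_c]; [by right | left].
have := subset_leq_card (subsetIr (ball s [:: x; y]) (~: ([set x in c] :|: component z))).
lia.
Qed.

Lemma ball_vertex_bound (G T : sgraph) (c : seq G) z k d s (x : G) : ambiguous T c z k ->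
  no_excursion c d -> 2 * s <= d ->
  #|ball s [:: x]| + size c + #|component z| <= #|G| + (2 * s + 1) \/
  #|ball s [:: x]| + size c <= #|G|.
Proof.
move=> amb ne le_d; have := card_ball_vertex x ne le_d.
have := ball_cycle_bound amb (ball1_connect (r := s) (x := x)); cbv zeta.
case=> [|[-> <-] le_c]; [by right | left].
have := subset_leq_card (subsetIr (ball s [:: x]) (~: ([set x in c] :|: component z))).
lia.
Qed.

Lemma cycle_legs (G : sgraph) (c : seq G) d t x : no_excursion c d -> t <= d ->
  2 * t + 1 < size c -> x \in c -> 1 < legs setT t x.
Proof.
move=> ne le_d lt_t xc; have sc := noexc_shortest ne; have [_ lt2 _] := sc.
have [i def_x] := cycP x xc; apply/card_gt1P.
exists (cyc x c i.+1), (cyc x c (i + (size c).-1)); rewrite !inE /=; split.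
- by rewrite {1}def_x (cyc_arc x i ne).
- have := cyc_arc_back x (i + (size c).-1) ne le_d lt_t.
  have -> : (i + (size c).-1).+1 = i + size c by lia.
  by rewrite cyc_addn -def_x.
apply/negP => /eqP/(cyc_inj sc)/eqP; rewrite -addn1 eqn_modDl.
by rewrite !modn_small; lia.
Qed.

Lemma amb_odd (G T : sgraph) (c : seq G) z k t : ambiguous T c z k ->
  no_excursion c (2 * t + 3) ->
  (forall x : G, #|ball t.+1 [:: x]| < k) -> (forall x : T, #|ball t.+1 [:: x]| < k) ->
  (exists x y : G, adj x y /\ k <= #|ball t.+1 [:: x; y]|) ->
  2 * t.+1 <= #|component z| -> False.
Proof.
move=> amb ne smallG smallT [x [y [axy big]]] le_Z.
have [le_n Z_gt0] := amb_sum amb; have lt_n := amb_lt amb; have lt_c := amb_girth amb.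
have lt_kn := amb_leq amb.
have boundG (u v : G) : adj u v -> #|ball t.+1 [:: u; v]| <= k.
  by move=> auv; have [|e|e] := @ball_edge_bound _ _ _ _ _ _ t.+1 u v amb ne _ auv; lia.
(* If these balls have at most [k] vertices in [T] too, the diameter is visible. Then [component z]
   has at least [2 * t + 3] vertices, and the ball around [x] and [y] at most [#|G| - k < k]. *)
have [all_small|] := boolP [forall p : T * T, adj p.1 p.2 ==> (#|ball t.+1 [:: p.1; p.2]| <= k)].
  have : 2 * t.+1 + 1 <= #|component z|.
    apply: (amb_component_odd amb) => // [u|u|u v auv]; try exact: ltnW.
    by have /implyP := forallP all_small (u, v); apply.
  by have [|e|e] := @ball_edge_bound _ _ _ _ _ _ t.+1 x y amb ne _ axy; lia.
rewrite negb_forall => /existsP[[u v]] /=; rewrite negb_imply -ltnNge => /andP[auv bigT].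
have := tree_centers t (amb_tree amb) auv.
have := @visible_vertices G T t k (fun m => 1 < m) (amb_card amb) (ltnW lt_kn)
  (amb_npat amb) (fun x => ltnW (smallG x)) (fun x => ltnW (smallT x)).
(* All vertices of the cycle have two legs, so [size c <= 2 + (#|G| - (k + 1)) <= k], a
   contradiction. *)
move=> <-; have : #|[set x in c]| <= #|[set x : G | 1 < legs setT t x]|.
  apply/subset_leq_card/subsetP => w; rewrite !inE => wc.
  by have sz := noexc_size ne; apply: (cycle_legs ne _ _ wc); lia.
have uc : uniq c by case: (amb_short amb) => /andP[].
by rewrite cardsE (card_uniqP uc) -(amb_card amb); lia.
Qed.

Lemma cycle_central_arcs (G : sgraph) (c : seq G) d t : no_excursion c d -> t <= d ->
  2 * t + 1 < size c ->
  2 * size c <= #|[set p : G * G | adj p.1 p.2 &&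
                    (arc_to setT t p.1 p.2 && arc_to setT t p.2 p.1)]|.
Proof.
move=> ne le_d lt_t; have sc := noexc_shortest ne; have [_ lt2 _] := sc.
have [x0 _] : exists x0 : G, true by case: (c) lt2 => // x0 s; exists x0.
pose f (i : 'I_(size c)) := (cyc x0 c i, cyc x0 c i.+1).
pose f' (i : 'I_(size c)) := (cyc x0 c i.+1, cyc x0 c i).
have cyc_ord (i j : 'I_(size c)) : cyc x0 c i = cyc x0 c j -> i = j.
  by move/(cyc_inj sc); rewrite !modn_small // => /val_inj.
have f_inj : injective f by move=> i j [/cyc_ord].
have f'_inj : injective f' by move=> i j [_ /cyc_ord].
have disj : [set f i | i : 'I_(size c)] :&: [set f' i | i : 'I_(size c)] = set0.
  apply/setP => p; rewrite !inE; apply/negP => /andP[/imsetP[i _ ->] /imsetP[j _]].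
  case=> /(cyc_inj sc) e1 /(cyc_inj sc)/eqP; rewrite -(addn1 i) -modnDml e1 modnDml.
  rewrite -{2}(addn0 j) addSn -addnS eqn_modDl !modn_small //; lia.
apply: (@leq_trans #|[set f i | i : 'I_(size c)] :|: [set f' i | i : 'I_(size c)]|).
  rewrite cardsU disj cards0 subn0 !card_imset // card_ord; lia.
apply/subset_leq_card/subsetP => p; rewrite in_setU.
have arcs (i : nat) : [/\ adj (cyc x0 c i) (cyc x0 c i.+1), arc_to setT t (cyc x0 c i) (cyc x0 c i.+1)
    & arc_to setT t (cyc x0 c i.+1) (cyc x0 c i)].
  by rewrite cyc_adj // (cyc_arc x0 i ne) // (cyc_arc_back x0 i ne).
case/orP=> /imsetP[i _ ->]; rewrite inE /=; have [axy a1 a2] := arcs i.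
  by rewrite axy a1 a2.
by rewrite adj_sym axy a1 a2.
Qed.

(** * Enumerated star sets with three legs at the centre *)

Definition legged_star (G : sgraph) r t (s : seq G) : bool :=
  if s is v :: _ then uniq s && star 0 r s && (2 < legs [set z in s] t v) else false.

Lemma legged_star_pattern (G T : sgraph) r t (s : seq G) (s' : seq T) :
  pattern s = pattern s' -> uniq s -> uniq s' -> legged_star r t s = legged_star r t s'.
Proof.
case: s s' => [|x s] [|y s'] eqp us us' //; try by have := size_pattern eqp.
rewrite /legged_star us us' (star_pattern 0 r eqp) //.
by rewrite (legs_pattern x y t (i := 0) eqp us us').
Qed.

Lemma card_legged_star_eq (G T : sgraph) r t k : (forall A, npat G k A = npat T k A) ->
  #|[set s : k.-tuple G | legged_star r t s]| = #|[set s : k.-tuple T | legged_star r t s]|.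
Proof.
move=> eqk.
have uniqE (K : sgraph) : [set s : k.-tuple K | legged_star r t s] =
    [set s : k.-tuple K | uniq s && legged_star r t s].
  apply/setP => s; rewrite !inE; case: (tval s) => [|x s'] //.
  by rewrite /legged_star; case: (uniq _).
rewrite !uniqE; apply: (card_fibers (f := fun s : k.-tuple G => pattern s)
                      (h := fun s : k.-tuple T => pattern s)) => [e|u v uu uv eqp].
  exact: eqk.
exact: legged_star_pattern.
Qed.

Lemma legs_ball_leq (G : sgraph) r t (v : G) : t < r ->
  legs (ball r [:: v]) t v <= legs setT t v.
Proof.
move=> lt_tr; apply/subset_leq_card/subsetP => y; rewrite !in_set => /andP[_ arcy].
have avy : adj v y by case/andP: arcy.
rewrite -(@arc_to_local _ (ball r [:: v])) // => w ww; rewrite in_ball1.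
  by apply: within_leq ww; apply: ltnW.
by apply: within_leq lt_tr _; apply: within_cons (in_setT y) avy ww.
Qed.

Lemma card_rooted_tuples (G : sgraph) k (v : G) (K : {set G}) : #|K| = k -> v \in K ->
  #|[set s : k.-tuple G | [&& uniq s, all (mem K) s & take 1 s == [:: v]]]| = (k - 1)`!.
Proof.
move=> cardK vK; have := card_extensions (m := k) (D := K) (s := [:: v]).
rewrite cardK ffactnn; apply=> //; last by rewrite -cardK (cardsD1 v) vK.
by move=> x; rewrite inE => /eqP->.
Qed.

(* A star set of [k] vertices with a given centre has [(k - 1)!] enumerations
   starting at its centre. *)
Lemma card_legged_star_upper (G : sgraph) r t k (H : {set G}) :
  (forall v : G, #|ball r [:: v]| <= k) ->
  (forall v : G, #|ball r [:: v]| = k -> 2 < legs (ball r [:: v]) t v -> v \in H) ->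
  #|[set s : k.-tuple G | legged_star r t s]| <= #|H| * (k - 1)`!.
Proof.
move=> smallG inH.
(* A star with [k] vertices fills the ball around its centre, which has at most [k]. *)
have legged_ball (s : k.-tuple G) v : legged_star r t s -> take 1 s = [:: v] ->
    [/\ uniq s, [set z in s] = ball r [:: v], #|ball r [:: v]| = k & v \in H].
  case: s => -[|w s] // ss /andP[/andP[us st] lg]; rewrite /= take0 => -[ew].
  rewrite -{}ew; have /subsetP sub : {subset [set z in w :: s] <= ball r [:: w]}.
    by move=> z; rewrite in_set => /(star_sub_ball st); rewrite /= take0.
  have card_s : #|[set z in w :: s]| = k.
    by rewrite cardsE (card_uniqP us); apply/eqP.
  have def_B : [set z in w :: s] = ball r [:: w].
    by apply/eqP; rewrite eqEcard sub card_s smallG.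
  by split=> //; [rewrite -def_B | apply: inH; rewrite -def_B].
have [->|[s0 /[!inE] s0N]] := set_0Vmem [set s : k.-tuple G | legged_star r t s].
  by rewrite cards0.
have [v0 _] : exists v0 : G, true by case: (tval s0) s0N => // v0 s _; exists v0.
have headP (s : k.-tuple G) : legged_star r t s -> take 1 s = [:: head v0 s].
  by case: (tval s) => [|w u] // _; rewrite /= take0.
rewrite -sum1_card (partition_big (fun s : k.-tuple G => head v0 s) (mem H)) /=; last first.
  by move=> s /[!inE] sN; have [] := legged_ball s _ sN (headP s sN).
rewrite -sum_nat_const; apply: leq_sum => v vH; rewrite sum1_card.
have [/eqP cardB|ncardB] := boolP (#|ball r [:: v]| == k); last first.
  rewrite eq_card0 // => s; rewrite unfold_in; apply/negP => /andP[/[!inE] sN /eqP hs].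
  by have [_ _ e _] := legged_ball s _ sN (headP s sN); rewrite hs in e; rewrite e eqxx in ncardB.
rewrite -(card_rooted_tuples (v := v) cardB); last by rewrite in_ball1 within0.
apply/subset_leq_card/subsetP => s; rewrite unfold_in => /andP[/[!inE] sN /eqP hs].
have [us defB _ _] := legged_ball s _ sN (headP s sN); rewrite hs in defB.
rewrite us -hs headP ?eqxx ?andbT //=; apply/allP => z zs.
by rewrite /= hs -defB inE.
Qed.

Lemma card_legged_star_lower (G : sgraph) r t k (v : G) (K1 K2 K3 : {set G}) :
  [/\ K1 != K2, K2 != K3 & K3 != K1] ->
  (forall K, K \in [:: K1; K2; K3] ->
    [/\ #|K| = k, v \in K, star_set r [:: v] K & 2 < legs K t v]) ->
  3 * (k - 1)`! <= #|[set s : k.-tuple G | legged_star r t s]|.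
Proof.
move=> [n12 n23 n31] KP.
pose S (K : {set G}) := [set s : k.-tuple G | [&& uniq s, all (mem K) s & take 1 s == [:: v]]].
have cardS K : K \in [:: K1; K2; K3] -> #|S K| = (k - 1)`!.
  by case/KP=> cardK vK _ _; apply: card_rooted_tuples.
have SP K (s : k.-tuple G) : K \in [:: K1; K2; K3] -> s \in S K -> [set z in tval s] = K.
  case/KP=> cardK _ _ _; rewrite inE => /and3P[us /allP sK _].
  apply/eqP; rewrite eqEcard cardK cardsE (card_uniqP us) size_tuple leqnn andbT.
  by apply/subsetP => z; rewrite inE => /sK.
have disjS K K' : K != K' -> K \in [:: K1; K2; K3] -> K' \in [:: K1; K2; K3] ->
    S K :&: S K' = set0.
  move=> neq KK KK'; apply/setP => s; rewrite in_setI in_set0; apply/negP => /andP[sK sK'].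
  by move/eqP: neq; apply; rewrite -(SP K s) // -(SP K' s).
have mem1 : K1 \in [:: K1; K2; K3] by rewrite !inE eqxx.
have mem2 : K2 \in [:: K1; K2; K3] by rewrite !inE eqxx orbT.
have mem3 : K3 \in [:: K1; K2; K3] by rewrite !inE eqxx !orbT.
have card_U : #|S K1 :|: S K2 :|: S K3| = 3 * (k - 1)`!.
  have d3 : (S K1 :|: S K2) :&: S K3 = set0.
    by rewrite setIUl (disjS K1) 1?eq_sym // (disjS K2) // setU0.
  rewrite cardsU d3 cardsU (disjS K1 K2) // !cards0 !subn0 !cardS //.
  by rewrite !mulSn mul0n addn0 addnA.
rewrite -card_U; apply/subset_leq_card/subsetP => s sU.
have [K [KK sK]] : exists K, K \in [:: K1; K2; K3] /\ s \in S K.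
  by move: sU; rewrite !in_setU -orbA => /or3P[]; [exists K1 | exists K2 | exists K3].
have def_K := SP K s KK sK; have [cardK vK stK lg] := KP K KK.
move: sK def_K; rewrite !inE => /and3P[us _]; case: (tval s) us => [|w u] // us.
move=> take1 def_K; have [ew] : [:: w] = [:: v] by rewrite -(eqP take1) /= take0.
rewrite -{}ew in take1 def_K stK lg *.
rewrite /legged_star us def_K lg andbT /star (eqP take1) def_K /rooted andTb.
by apply/allP => z zu; apply: (forall_inP stK); rewrite -def_K inE.
Qed.

(** By [no_excursion] with empty interior, only two neighbours of [v] are on the cycle. *)
Lemma leg_off_cycle (G : sgraph) (c : seq G) d t (v : G) : no_excursion c d -> v \in c ->
  2 < legs setT t v -> exists2 y, y \notin c & arc_to setT t v y.
Proof.
move=> ne vc /card_gt2P[y1 [y2 [y3 [[]]]]]; rewrite !inE /= => a1 a2 a3 [n12 n23 n31].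
have [i def_v] := cycP v vc.
have next y : arc_to setT t v y -> y \in c ->
    y = cyc v c i.+1 \/ y = cyc v c (i + (size c).-1).
  move=> /andP[avy _] yc; have [j def_y] := cycP v yc.
  have [||||_] := noexc_path ne (x0 := v) (i := i) (i' := j) (m := [::]).
  - by rewrite /= -def_v -def_y avy.
  - by rewrite /= inE !andbT -def_v -def_y; apply: contraTneq avy => ->; rewrite adj_irrefl.
  - by [].
  - exact: noexc_pos ne.
  by rewrite -def_y.
have [yc1|] := boolP (y1 \in c); last by exists y1.
have [yc2|] := boolP (y2 \in c); last by exists y2.
have [yc3|] := boolP (y3 \in c); last by exists y3.
exfalso; case: (next y1 a1 yc1) (next y2 a2 yc2) (next y3 a3 yc3) n12 n23 n31 => ->;
  by case=> ->; case=> ->; rewrite ?eqxx.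
Qed.

Lemma shortest_no_triangle (G : sgraph) (c : seq G) (x y w : G) : shortest c -> 3 < size c ->
  adj x y -> adj y w -> adj w x -> False.
Proof.
move=> [_ _ min_c] lt3 axy ayw awx.
have neq (a b : G) : adj a b -> a != b by apply: contraTneq => ->; rewrite adj_irrefl.
have := min_c [:: x; y; w]; rewrite /ucycle /= axy ayw awx !inE negb_or.
rewrite (neq _ _ axy) (neq _ _ ayw) eq_sym (neq _ _ awx) => /(_ isT isT).
by rewrite leqNgt lt3.
Qed.

Lemma even_ball_leq (G T : sgraph) (c : seq G) z k t : ambiguous T c z k ->
  no_excursion c (2 * t + 2) -> 2 * t + 1 <= #|component z| ->
  forall v : G, #|ball t.+1 [:: v]| <= k.
Proof.
move=> amb ne le_Z v.
have := amb_lt amb; have := amb_girth amb; have [le_n Z_gt0] := amb_sum amb.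
by have [|e|e] := @ball_vertex_bound _ _ _ _ _ _ t.+1 v amb ne; lia.
Qed.

(** The ball has at most [2 * t + 3] vertices on the cycle, and [U] has at most [k - 2 * t - 3]. For
    [k] vertices both bounds are tight: the ball contains [U], and its centre is on the cycle since
    other balls meet the cycle in fewer vertices. *)
Lemma even_full_ball (G T : sgraph) (c : seq G) z k t (v : G) : ambiguous T c z k ->
  no_excursion c (2 * t + 2) -> 2 * t + 1 <= #|component z| ->
  #|ball t.+1 [:: v]| = k ->
  v \in c /\ forall u, u \notin c -> ~~ connect (@adj G) z u -> u \in ball t.+1 [:: v].
Proof.
move=> amb ne le_Z cardB; have lt_n := amb_lt amb; have lt_c := amb_girth amb.
have [le_n Z_gt0] := amb_sum amb.
have := ball_cycle_bound amb (ball1_connect (r := t.+1) (x := v)); cbv zeta.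
set U := ~: _; rewrite cardB; case=> [|[card_k card_U]]; first by lia.
have le_BU := subset_leq_card (subsetIr (ball t.+1 [:: v]) U).
have le_d : 2 * t.+1 <= 2 * t + 2 by lia.
have le_Bc := card_ball_vertex v ne le_d.
split.
  apply/negPn/negP => vc; have := card_ball_off_cycle ne le_d vc.
  rewrite /= => le_B2. have {card_k} : k <= 2 * t + 1 + #|U| by rewrite card_k leq_add. move: card_U le_Z lt_n lt_c. clear. lia.
move=> u uc zu; have uU : u \in U by rewrite !inE negb_or uc.
have : U \subset ball t.+1 [:: v].
  apply/setIidPr/eqP; rewrite eqEcard subsetIr /=; lia.
by move/subsetP/(_ u uU).
Qed.

(** The tip of a leg of [u] off the cycle lies in the full ball of [v], so [branch_tip] leaves at
    most one step between [u] and [v]. Three centres would form a triangle, but the shortest cycle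
    has more than three vertices. *)
Lemma even_centers (G T : sgraph) (c : seq G) z k t : ambiguous T c z k ->
  no_excursion c (2 * t + 2) -> 2 * t + 1 <= #|component z| ->
  2 < k ->
  #|[set v : G | (#|ball t.+1 [:: v]| == k) && (2 < legs setT t.-1 v)]| <= 2.
Proof.
move=> amb ne le_Z lt2k; rewrite leqNgt; apply/negP => /card_gt2P[v1 [v2 [v3 [[]]]]].
rewrite !inE => /andP[/eqP b1 l1] /andP[/eqP b2 l2] /andP[/eqP b3 l3] [n12 n23 n31].
have near (u v : G) : #|ball t.+1 [:: u]| = k -> #|ball t.+1 [:: v]| = k ->
    2 < legs setT t.-1 u -> u != v -> adj u v.
  move=> bu bv lu neq_uv; have [uc _] := even_full_ball amb ne le_Z bu.
  have [vc fullv] := even_full_ball amb ne le_Z bv.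
  have [y yc arcy] := leg_off_cycle ne uc lu.
  have [|w [wc uw tip]] := branch_tip ne uc yc arcy; first by lia.
  have zw : ~~ connect (@adj G) z w.
    apply: contra (amb_comp amb uc) => zw; apply: connect_trans zw _.
    by rewrite connect_adj_sym.
  have := fullv w wc zw; rewrite in_ball1 => /(tip t.+1 v) close.
  have /withinP[p [pp lp sp _]] : within setT 1 u v.
    have sum_t : t.-1.+1 + t.+1 <= 2 * t + 2 by clear; lia.
    by apply: within_leq (close sum_t vc); clear; lia.
  case: p pp lp sp => [|x [|x' p]] //= pp lp _; first by rewrite lp eqxx in neq_uv.
  by rewrite -lp; case/andP: pp.
apply: (shortest_no_triangle (amb_short amb) _ (near v1 v2 b1 b2 l1 n12) (near v2 v3 b2 b3 l2 n23)
  (near v3 v1 b3 b1 l3 n31)).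
by have := amb_girth amb; lia.
Qed.

Lemma amb_even (G T : sgraph) (c : seq G) z k t : ambiguous T c z k ->
  no_excursion c (2 * t + 2) ->
  (forall x y : G, adj x y -> #|ball t [:: x; y]| < k) ->
  (forall x y : T, adj x y -> #|ball t [:: x; y]| < k) ->
  (exists x : G, k <= #|ball t.+1 [:: x]|) ->
  2 * t + 1 <= #|component z| -> False.
Proof.
move=> amb ne smallG smallT [x big] le_Z.
have [le_n Z_gt0] := amb_sum amb; have lt_n := amb_lt amb; have lt_c := amb_girth amb.
have lt_kn := amb_leq amb; have boundG := even_ball_leq amb ne le_Z.
(* From [k + 2 <= #|G| < 2 * k] follows [3 <= k], and [k = 3] would force [#|G| = 5]. *)
have k4 : 4 <= k by have := amb_exn amb; lia.
have [/forallP all_small|] := boolP [forall v : T, #|ball t.+1 [:: v]| <= k].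
  have : 2 * t.+1 <= #|component z| by apply: (amb_component_even amb).
  by have [|e|e] := @ball_vertex_bound _ _ _ _ _ _ t.+1 x amb ne; lia.
rewrite negb_forall => /existsP[v]; rewrite -ltnNge => bigT.
(* Both orientations of each edge of the cycle are central in [G], so [size c <= legs setT t v +
   (#|G| - (k + 1))], where [k < size c] and [#|G| < 2 * k]. *)
have legs_v : 2 < legs setT t v.
  have := tree_central_arcs t v (amb_tree amb).
  have := @visible_edges G T t k andb (amb_card amb) (ltnW lt_kn) (amb_npat amb)
    (fun x y axy => ltnW (smallG x y axy)) (fun x y axy => ltnW (smallT x y axy)).
  move=> <-; rewrite -(amb_card amb).
  have := @cycle_central_arcs _ _ _ t ne; have := noexc_size ne; lia.
case/card_gt2P: legs_v => y1 [y2 [y3 [[]]]]; rewrite !inE /= => a1 a2 a3 [n12 n23 n31].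
have acT : acyclic T by case: (amb_tree amb).
have [adj1 [q1 [p1 s1 w1]]] := arc_leg a1.
have [adj2 [q2 [p2 s2 w2]]] := arc_leg a2.
have [adj3 [q3 [p3 s3 w3]]] := arc_leg a3.
(* The legs are rotated: each set lacks the tip of one leg and contains the other two tips, so the
   three sets differ. *)
have [K1 [cK1 vK1 sK1 lK1 [o11 i12 i13]]] :=
  three_legs_star (q1 := q1) (q2 := q2) (q3 := q3) acT smallT bigT (fun=> k4)
    (And3 n12 n23 n31) (And4 adj1 p1 s1 w1) (And4 adj2 p2 s2 w2) (And4 adj3 p3 s3 w3).
have [K2 [cK2 vK2 sK2 lK2 [o22 i23 i21]]] :=
  three_legs_star (q1 := q2) (q2 := q3) (q3 := q1) acT smallT bigT (fun=> k4)
    (And3 n23 n31 n12) (And4 adj2 p2 s2 w2) (And4 adj3 p3 s3 w3) (And4 adj1 p1 s1 w1).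
have [K3 [cK3 vK3 sK3 lK3 [o33 i31 i32]]] :=
  three_legs_star (q1 := q3) (q2 := q1) (q3 := q2) acT smallT bigT (fun=> k4)
    (And3 n31 n12 n23) (And4 adj3 p3 s3 w3) (And4 adj1 p1 s1 w1) (And4 adj2 p2 s2 w2).
have lower : 3 * (k - 1)`! <= #|[set s : k.-tuple T | legged_star t.+1 t.-1 s]|.
  apply: (@card_legged_star_lower T t.+1 t.-1 k v K1 K2 K3).
    by split; [apply: contraTneq i12 => -> | apply: contraTneq i23 => ->
             | apply: contraTneq i31 => ->].
  by move=> K; rewrite !inE => /or3P[]/eqP->.
(* The count carries over to [G], where at most two centres allow only twice the factorial of
   [k - 1]. *)
rewrite -(card_legged_star_eq _ _ (amb_npat amb)) in lower.
have := even_centers amb ne le_Z (ltnW k4); set H := [set v | _] => le_H.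
have inH u : #|ball t.+1 [:: u]| = k -> 2 < legs (ball t.+1 [:: u]) t.-1 u -> u \in H.
  move=> cardB lg; rewrite inE cardB eqxx; apply: leq_trans lg _.
  by apply: legs_ball_leq; rewrite ltnS leq_pred.
have := leq_trans lower (card_legged_star_upper boundG inH).
by rewrite leq_pmul2r ?fact_gt0 // leqNgt ltnS le_H.
Qed.

(** * The least diameter of a big ball *)

(* [d] stands for the diameter: [2 * r] for vertex balls of radius [r] and
   [2 * r + 1] for edge balls. *)
Definition big_ball (G : sgraph) k d : bool :=
  if odd d then [exists p : G * G, adj p.1 p.2 && (k <= #|ball d./2 [:: p.1; p.2]|)]
  else [exists x : G, k <= #|ball d./2 [:: x]|].

Lemma big_ball_eq (G T : sgraph) k d : (forall A, npat G k A = npat T k A) -> 1 < k ->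
  big_ball G k d = big_ball T k d.
Proof.
suff half (X Y : sgraph) : (forall A, npat X k A = npat Y k A) -> 1 < k ->
    big_ball X k d -> big_ball Y k d.
  by move=> eqk lt1; apply/idP/idP; apply: half.
move=> eqk lt1; rewrite /big_ball; case: odd => /existsP.
  case=> -[x y] /= /andP[axy big].
  have [|||s rs bs] := visible_big (b := 1) (s := [:: x; y]) eqk _ _ _ big; rewrite //=.
  - by rewrite inE andbT; apply: contraTneq axy => ->; rewrite adj_irrefl.
  - by rewrite /rooted /= axy.
  case/tupleP: s rs bs => a s; case/tupleP: s => b s; rewrite tuple0 => /andP[_ /= /andP[aab _]] bs.
  by apply/existsP; exists (a, b); rewrite /= aab.
case=> x big; have [|||s rs bs] := visible_big (b := 0) (s := [:: x]) eqk _ _ _ big; rewrite //=.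
  exact: ltnW.
by case/tupleP: s rs bs => a s; rewrite tuple0 => _ bs; apply/existsP; exists a.
Qed.

(** The vertices with index below [k] lie in the ball around the middle of this stretch, a vertex or
    an edge according to the parity of [k.-1]. *)
Lemma big_ball_cycle (G : sgraph) (c : seq G) k : shortest c -> 0 < k < size c ->
  big_ball G k k.-1.
Proof.
move=> sc /andP[k_gt0 lt_k]; have [_ lt2 _] := sc.
have [x0 _] : exists x0 : G, true by case: (c) lt2 => // x0 s; exists x0.
have card_arc (B : {set G}) : (forall j, j < k -> cyc x0 c j \in B) -> k <= #|B|.
  move=> inB; have inj : injective (fun j : 'I_k => cyc x0 c j).
    move=> i j /(cyc_inj sc); rewrite !modn_small; [exact: val_inj | |];
      exact: leq_trans (ltn_ord _) (ltnW lt_k).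
  rewrite -{1}(card_ord k) -(card_imset predT inj); apply/subset_leq_card/subsetP => _ /imsetP[j _ ->].
  exact: inB.
have fwd i j : i <= j -> within setT (j - i) (cyc x0 c i) (cyc x0 c j).
  by move=> le_ij; have := cyc_within x0 i (j - i) sc; rewrite subnKC.
rewrite /big_ball; have := odd_double_half k.-1; set r := k.-1./2; case: odd => def_k.
  apply/existsP; exists (cyc x0 c r, cyc x0 c r.+1); rewrite /= cyc_adj //=.
  apply: card_arc => j lt_j; rewrite in_ball2.
  have [le_rj|lt_jr] := ltnP r j; apply/orP; [right|left].
    by apply: within_leq (fwd _ _ le_rj); lia.
  by rewrite within_sym; apply: within_leq (fwd _ _ lt_jr); lia.
apply/existsP; exists (cyc x0 c r); apply: card_arc => j lt_j; rewrite in_ball1.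
have [le_rj|/ltnW lt_jr] := leqP r j.
  by apply: within_leq (fwd _ _ le_rj); lia.
by rewrite within_sym; apply: within_leq (fwd _ _ lt_jr); lia.
Qed.

Lemma not_ambiguous (G T : sgraph) (c : seq G) z k : ~ ambiguous T c z k.
Proof.
move=> amb; have [le_n Z_gt0] := amb_sum amb; have lt_n := amb_lt amb.
have lt_c := amb_girth amb; have lt_kn := amb_leq amb.
have exd : exists d, big_ball G k d.
  by exists k.-1; apply: big_ball_cycle (amb_short amb) _; lia.
case: (ex_minnP exd) => d bigd min_d.
have le_dk : d <= k.-1 by apply: min_d; apply: big_ball_cycle (amb_short amb) _; lia.
have k_gt1 : 1 < k by lia.
(* By [big_ball_eq] the least diameter [d] is the same for [G] and [T], so all smaller diameters are
   visible. *)
have not_big (X : sgraph) m : X = G \/ X = T -> m < d -> ~~ big_ball X k m.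
  have nbG : m < d -> ~~ big_ball G k m by rewrite ltnNge; apply: contra => /min_d.
  by case=> -> //; rewrite -(big_ball_eq m (amb_npat amb) k_gt1).
have smallV (X : sgraph) r : X = G \/ X = T -> 2 * r < d ->
    forall x : X, #|ball r [:: x]| < k.
  move=> XGT lt_d x; have := not_big X _ XGT lt_d; rewrite ltnNge; apply: contra => big.
  by rewrite /big_ball mul2n odd_double doubleK; apply/existsP; exists x.
have smallE (X : sgraph) r : X = G \/ X = T -> 2 * r + 1 < d ->
    forall x y : X, adj x y -> #|ball r [:: x; y]| < k.
  move=> XGT lt_d x y axy; have := not_big X _ XGT lt_d; rewrite ltnNge; apply: contra => big.
  rewrite /big_ball addn1 mul2n /= odd_double uphalf_double.
  by apply/existsP; exists (x, y); rewrite /= axy.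
have inG : G = G \/ G = T by left.
have inT : T = G \/ T = T by right.
(* The bounds [d <= k - 1], [k < size c] and [#|G| < 2 * k] give [d + 1 < size c] and
   [#|G| + 3 <= 2 * size c]. *)
have noexc : d <= (#|component z|).+1 -> 0 < d -> no_excursion c d.
  move=> le_dZ d_gt0; apply: few_vertices_no_excursion (amb_short amb) _ d_gt0 le_dZ (amb_comp amb) _; lia.
(* Balls of diameter 0 or 1 have at most two vertices, fewer than [k], so [d] is at least 2. *)
have [t [def_d|def_d]] : exists t, d = 2 * t + 2 \/ d = 2 * t + 3.
  have d_gt1 : 1 < d.
    rewrite ltnNge; apply: contraL bigd; case: (d) => [|[|//]] _; rewrite /big_ball /=.
      rewrite negb_exists; apply/forallP => x; rewrite -ltnNge.
      rewrite (_ : ball 0 [:: x] = [set x]) ?cards1 //.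
      by apply/setP => y; rewrite in_ball1 inE eq_sym.
    rewrite negb_exists; apply/forallP => -[x y] /=; rewrite negb_and -ltnNge orbC.
    apply/orP; left; rewrite (_ : ball 0 [:: x; y] = [set x; y]).
      by rewrite cards2; case: (x != y); lia.
    by apply/setP => w; rewrite in_ball2 !inE !(eq_sym w).
  exists (d - 2)./2; have := odd_double_half (d - 2); case: odd; lia.
(* Diameter [d - 1] is visible, which gives this bound; for [t = 0] it only says that the component
   is non-empty. *)
- have le_Z : 2 * t + 1 <= #|component z|.
    case: (t) def_d => [//|t'] def_d.
    by apply: (amb_component_odd amb) => [x|x|x y axy|x y axy]; apply: ltnW;
      [apply: (smallV G) | apply: (smallV T) | apply: (smallE G) | apply: (smallE T)]; rewrite //; lia.
  apply: (amb_even amb (t := t)) => //.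
  - by rewrite -def_d; apply: noexc; lia.
  - by apply: smallE => //; lia.
  - by apply: smallE => //; lia.
  move: bigd; rewrite /big_ball def_d (_ : 2 * t + 2 = t.+1.*2) ?odd_double ?doubleK; last by lia.
  by case/existsP=> x big; exists x.
have le_Z : 2 * t.+1 <= #|component z|.
  by apply: (amb_component_even amb) => x; apply: ltnW;
    [apply: (smallV G) | apply: (smallV T)]; rewrite //; lia.
apply: (amb_odd amb (t := t)) => //.
- by rewrite -def_d; apply: noexc; lia.
- by apply: smallV => //; lia.
- by apply: smallV => //; lia.
move: bigd; rewrite /big_ball def_d (_ : 2 * t + 3 = t.+1.*2.+1); last by lia.
have -> : t.+1.*2.+1./2 = t.+1 by lia.
rewrite [odd _]/= odd_double /=.
by case/existsP=> -[x y] /= /andP[axy big]; exists x, y.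
Qed.

Theorem corollary1p3 (l n : nat) (hl : 1 <= l) (hn : 2 * l + 1 <= n)
    (hnl : (n, l) <> (5, 2)) :
  recognizable n l is_tree.
Proof.
move=> T G cardT cardG treeT eq_deck.
have eqk := same_deck_npat eq_deck.
have eqn : #|G| = #|T| by rewrite cardT.
have [|||//|[c [z amb]]] := not_tree_ambiguous treeT eqn eqk; rewrite ?cardG.
- lia.
- lia.
- by move=> e1 e2; apply: hnl; congr (_, _); lia.
by case: (not_ambiguous amb).
Qed.
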